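(* Let $z\geq 1$. If $z>1$, let $u$ be any minimiser of $E$ over $\mathcal{X}_1$; if $z=1$, let $u$ be any minimiser of $E$ over $\mathcal{B}_1$. Then $u$ is symmetric nonincreasing, i.e. $u(x)=u(-x)$ for all $x$ and $u(x)$ is a nonincreasing function of $x$ for $x\geq 0$.
   Context: $H^1$ is the space of functions $u:\mathbb{R}\to\mathbb{R}$ with $\|u'\|_2^2+\|u\|_2^2<\infty$ (continuous representatives are used). $\mathcal{X}=\{u\in H^1:\int_{\mathbb{R}}|x|u(x)^2\,dx<\infty\}$ and $\mathcal{X}_1=\{u\in\mathcal{X}:\|u\|_2=1\}$. $\mathcal{B}=\{u\in H^1:\iint_{xy>0}\min\{|x|,|y|\}u(x)^2u(y)^2\,dx\,dy<\infty\}$ and $\mathcal{B}_1=\{u\in\mathcal{B}:\|u\|_2=1\}$. The energy, for functions with $\|u\|_2=1$ and point charge background $-z\delta_0$, is $$E[u]=\int_{\mathbb{R}}|u'(x)|^2\,dx+\frac12\int_{\mathbb{R}}\int_{\mathbb{R}}\bigl[z(|x|+|y|)-|x-y|\bigr]u(x)^2u(y)^2\,dx\,dy .$$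
   Formalization: Since E[u]=E[-u], the negative of a minimiser is again a minimiser, so the claim can hold only up to a global sign; what is proved is that either u or -u is symmetric nonincreasing, which gives the stated claim for every minimiser u that is nonnegative. *)

(* Defs.v *)
From HB Require Import structures.
From mathcomp Require Import all_boot all_order all_algebra.
From mathcomp Require Import all_classical all_reals all_analysis.

Set Implicit Arguments.
Unset Strict Implicit.
Unset Printing Implicit Defensive.

Import Order.TTheory GRing.Theory Num.Theory.
Import numFieldNormedType.Exports.

Local Open Scope classical_set_scope.
Local Open Scope ring_scope.

Definition test_function (R : realType) (phi : R -> R) : Prop :=
  [/\ forall x, derivable phi x 1,
      continuous (derive1 phi) &
      compact (closure [set x | phi x != 0])].

(* Test functions are C^1 with compact support (as in Brezis' definition of
   W^{1,p}); by mollification this gives the same notion as C^oo_c. *)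
Definition weak_derivative (R : realType) (u g : R -> R) : Prop :=
  [/\ locally_integrable setT u, locally_integrable setT g &
      forall phi : R -> R, test_function phi ->
        (\int[lebesgue_measure]_x (u x * derive1 phi x)%:E =
         - \int[lebesgue_measure]_x (g x * phi x)%:E)%E].

(* A weak derivative is unique up to a.e. equality, and [wderiv] is only used
   under integrals over R; its value is irrelevant when none exists. *)
Definition wderiv (R : realType) (u : R -> R) : R -> R :=
  xget (fun=> 0) [set g | weak_derivative u g].

Definition norm2 (R : realType) (u : R -> R) : \bar R :=
  'N[lebesgue_measure]_(2%:E) [EFin \o u]%E.

(* [continuous u] selects the continuous representative. *)
Definition H1 (R : realType) : set (R -> R) :=
  [set u | [/\ continuous u,
               exists g, weak_derivative u g &
               (norm2 (wderiv u) ^+ 2 + norm2 u ^+ 2 < +oo)%E]].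

Definition calX (R : realType) : set (R -> R) :=
  [set u | H1 u /\
     (\int[lebesgue_measure]_x (`|x| * u x ^+ 2)%:E < +oo)%E].

Definition calX1 (R : realType) : set (R -> R) :=
  [set u | calX u /\ norm2 u = 1%E].

Definition calB (R : realType) : set (R -> R) :=
  [set u | H1 u /\
     (\int[lebesgue_measure \x lebesgue_measure]_(p in
          [set p : R * R | (0 < p.1 * p.2)%R])
        (Num.min `|p.1| `|p.2| * u p.1 ^+ 2 * u p.2 ^+ 2)%:E < +oo)%E].

Definition calB1 (R : realType) : set (R -> R) :=
  [set u | calB u /\ norm2 u = 1%E].

Definition energy (R : realType) (z : R) (u : R -> R) : \bar R :=
  (\int[lebesgue_measure]_x (`|wderiv u x| ^+ 2)%:E +
   (2^-1)%:E * \int[lebesgue_measure]_x \int[lebesgue_measure]_y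
     ((z * (`|x| + `|y|) - `|x - y|) * u x ^+ 2 * u y ^+ 2)%:E)%E.

Definition minimiser (R : realType) (F : (R -> R) -> \bar R)
    (A : set (R -> R)) (u : R -> R) : Prop :=
  A u /\ forall v, A v -> (F u <= F v)%E.

Definition symmetric_nonincreasing (R : realType) (u : R -> R) : Prop :=
  (forall x, u x = u (- x)) /\
  (forall x y, 0 <= x -> x <= y -> u y <= u x).

(* Main.v *)
Require Import Defs.
From HB Require Import structures.
From mathcomp Require Import all_boot all_order all_algebra.
From mathcomp Require Import all_classical all_reals all_analysis.
From mathcomp Require Import measurable_realfun.
From mathcomp Require Import ring lra.
Import Order.TTheory GRing.Theory Num.Theory.
Import numFieldNormedType.Exports.

(** Write [rho = u^2], and let [F(t)], [G(t)] be the masses of [rho] on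
    [t, +oo[ and on ]-oo, -t] for [t >= 0].  The kernel of the energy is
    [(z - 1) (|x| + |y|)] plus twice [min(|x|, |y|)] on pairs of the same sign,
    and [min(x, y)] is the length of the set of levels [t >= 0] below both [x]
    and [y].  By Tonelli, for [u] of norm 1,
<<
    E[u] = int |u'|^2 + int_0^oo (z - 1) (F + G) + F^2 + G^2 dt
>>
    ([energyE], [moment_tails], [self_energy_tails]).  This is increasing in
    the tails, so a competitor which moves mass towards the origin without
    raising the kinetic energy has the same tails as the minimiser
    ([minimiser_tails]).  For [z = 1] only the quadratic part is controlled, and
    its finiteness is exactly membership in the space B; for [z > 1] the linear
    part is controlled as well, and dominates the quadratic one since tails are
    at most 1.  This treats both cases at once.

    Two competitors suffice.

    - Averaging: [v(x)^2 = (u(x)^2 + u(-x)^2) / 2].  Both tails of [v] are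
      [(F + G) / 2], and [2 ((F + G) / 2)^2 <= F^2 + G^2] with equality only if
      [F = G].  Hence [F = G] and [u^2] is even ([minimiser_even]).

    - Refilling: if [|u|] is even but [|u x| < |u y|] with [0 <= x < y], choose
      [b] in ]x, y[ where [l = |u b|] lies strictly in between.  Take from
      [(u^2 - l^2)^+] outside [-b, b] and give the same mass to
      [(l^2 - u^2)^+] inside, each in a fixed proportion.  All mass moves
      inwards, so no tail grows, while the tails at [b <= t < y] strictly
      decrease: a contradiction ([refill_rigid], [minimiser_nonincreasing]).

    In both cases [v] is locally a Euclidean norm
    [sqrt ((1 - c) a^2 + c b^2)] of 1-Lipschitz functions of values of [u], so
    its increments are bounded by the integral of a function [k] with
    [int k^2 <= int |u'|^2] ([mix_lip], [mix_integral], [refill_lip]).  That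
    such a [v] has a weak derivative bounded by [k] is
    [weak_derivative_dominated]: a density comes from the Radon-Nikodym theorem
    ([dominated_increments_primitive]), indefinite integrals have weak
    derivatives and conversely ([primitive_weak_derivative],
    [weak_derivative_primitive]), and Lebesgue differentiation compares the
    density with [k].

    Finally [|u|] is even and nonincreasing on [0, +oo[, so the continuous
    function [u] cannot change sign. *)

Set Implicit Arguments.
Unset Strict Implicit.
Unset Printing Implicit Defensive.
Local Open Scope classical_set_scope.
Local Open Scope ring_scope.

(** * A continuously differentiable step *)

Section smooth_step.
Context {R : realType}.
Implicit Types x h : R.

(** A second-order Taylor bound determines the derivative; such bounds are
    stable under affine changes of variable, unlike the case analysis that
    defines the functions below. *)
Lemma quadratic_is_derive (f : R -> R) x d C :
  (forall h, `|f (x + h) - f x - h * d| <= C * h ^+ 2) -> is_derive x 1 f d.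
Proof.
move=> fC.
suff cv : h^-1 *: (f (h *: 1 + x) - f x) @[h --> 0^'] --> d.
  split; first by apply/cvg_ex; exists d.
  exact: cvg_lim cv.
apply/cvgrPdist_le => e e0; near=> h.
have h0 : h != 0 by near: h; exact: nbhs_dnbhs_neq.
have -> : d - h^-1 *: (f (h *: 1 + x) - f x) =
    - h^-1 * (f (x + h) - f x - h * d).
  by rewrite /GRing.scale/= mulr1 (addrC h x); field.
rewrite normrM normrN normfV ler_pdivrMl ?normr_gt0//.
apply: le_trans (fC _) _.
rewrite -(real_normK (num_real h)) expr2 mulrCA ler_wpM2l//.
apply: (@le_trans _ _ ((`|C| + 1) * `|h|)).
  by rewrite ler_wpM2r// (le_trans (ler_norm C))// lerDl.
rewrite -ler_pdivlMl ?ltr_wpDl// mulrC.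
near: h; apply: dnbhs0_le.
by rewrite divr_gt0// ltr_wpDl.
Unshelve. all: by end_near. Qed.

Definition sqpos x : R := Num.max 0 x ^+ 2.

Lemma sqpos_taylor x h : `|sqpos (x + h) - sqpos x - 2 * h * Num.max 0 x| <= h ^+ 2.
Proof.
rewrite /sqpos ler_norml; case: (leP 0 (x+h)) => ?; case: (leP 0 x) => ?; nra.
Qed.

(** A second difference of the truncated square: it is C^1, and its explicit
    derivative [tent] is a nonnegative bump on [0, 2] of integral 1. *)
Definition step x : R := (sqpos x - 2 * sqpos (x - 1) + sqpos (x - 2)) / 2.
Definition tent x : R := Num.max 0 x - 2 * Num.max 0 (x - 1) + Num.max 0 (x - 2).

Lemma step_taylor x h : `|step (x + h) - step x - h * tent x| <= 2 * h ^+ 2.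
Proof.
have := sqpos_taylor x h; have := sqpos_taylor (x - 1) h.
have := sqpos_taylor (x - 2) h.
rewrite /step /tent (addrAC x (- 1) h) (addrAC x (- 2) h).
by rewrite !ler_norml => /andP[? ?] /andP[? ?] /andP[? ?]; lra.
Qed.

Lemma step0 x : x <= 0 -> step x = 0.
Proof.
by move=> x0; rewrite /step /sqpos !max_l; lra.
Qed.

Lemma step1 x : 2 <= x -> step x = 1.
Proof.
by move=> x0; rewrite /step /sqpos !max_r; lra.
Qed.

Lemma tent_ge0 x : 0 <= tent x.
Proof.
rewrite /tent; case: (leP 0 x) => ?; case: (leP 0 (x - 1)) => ?;
  case: (leP 0 (x - 2)) => ?; lra.
Qed.

Lemma tent0l x : x <= 0 -> tent x = 0.
Proof. by move=> x0; rewrite /tent !max_l; lra. Qed.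

Lemma tent0r x : 2 <= x -> tent x = 0.
Proof. by move=> x0; rewrite /tent !max_r; lra. Qed.

Lemma continuous_tent : continuous tent.
Proof.
move=> x; rewrite /tent.
have c0 (c : R) : Num.max 0 (y - c) @[y --> x] --> Num.max 0 (x - c).
  apply: (@continuous_max R R (cst 0) (fun y => y - c) x); first exact: cvg_cst.
  by apply: cvgB; [exact: cvg_id|exact: cvg_cst].
apply: cvgD; last exact: c0.
apply: cvgB; last by apply: cvgM; [exact: cvg_cst|exact: c0].
by apply: (@continuous_max R R (cst 0) id x); [exact: cvg_cst|exact: cvg_id].
Qed.

Lemma is_derive_scaled_step (m a x : R) :
  is_derive x 1 (fun y => step (m * (y - a))) (m * tent (m * (x - a))).
Proof.
apply: (@quadratic_is_derive _ _ _ (2 * m ^+ 2)) => h.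
have -> : m * (x + h - a) = m * (x - a) + m * h by ring.
have := step_taylor (m * (x - a)) (m * h).
have -> : m * h * tent (m * (x - a)) = h * (m * tent (m * (x - a))) by ring.
by have -> : 2 * (m * h) ^+ 2 = 2 * m ^+ 2 * h ^+ 2 by ring.
Qed.

Lemma continuous_scaled_tent (m a : R) :
  continuous (fun y : R => m * tent (m * (y - a))).
Proof.
move=> x; apply: cvgM; first exact: cvg_cst.
apply: (@continuous_comp _ _ _ (fun y => m * (y - a)) tent); last exact: continuous_tent.
by apply: cvgM; [exact: cvg_cst|apply: cvgB; [exact: cvg_id|exact: cvg_cst]].
Qed.

End smooth_step.

(** * Weak derivatives and indefinite integrals *)

Section weak_derivative_primitive.
Context {R : realType}.
Notation mu := (@lebesgue_measure R).
Implicit Types (f g u v k F : R -> R) (a b x : R).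

Lemma step01 x : 0 <= step x <= 1.
Proof.
by rewrite /step /sqpos; case: (leP 0 x) => ?; case: (leP 0 (x - 1)) => ?;
  case: (leP 0 (x - 2)) => ?; nra.
Qed.

Lemma step_cvg x : step (n.+1%:R * x) @[n --> \oo] --> ((0 < x)%R%:R : R).
Proof.
have [x0|x0] := ltP 0 x; last first.
  by under eq_fun do rewrite step0 ?mulr_ge0_le0//; exact: cvg_cst.
apply: cvg_near_cst; near=> n; apply: step1.
rewrite -ler_pdivrMr// (@le_trans _ _ n%:R) ?ler_nat//.
by near: n; exact: nbhs_infty_ger.
Unshelve. all: by end_near. Qed.

Lemma locally_integrable_itv g a b : locally_integrable setT g ->
  mu.-integrable `[a, b] (EFin \o g).
Proof.
move=> [mg _ ig]; apply/integrableP; split.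
  by apply/measurable_EFinP; exact: measurable_funS mg.
exact: ig (@segment_compact _ _ _).
Qed.

Lemma continuous_locally_integrable u : continuous u -> locally_integrable setT u.
Proof.
move=> cu; split; [exact: continuous_measurable_fun|exact: openT|].
move=> K _ cK.
have /integrableP[_] := continuous_compact_integrable cK (continuous_subspaceT cu).
exact.
Qed.

Lemma C1_integral F f a b : a <= b -> (forall x, is_derive x 1 F (f x)) ->
  continuous f -> \int[mu]_(x in `[a, b]) f x = F b - F a.
Proof.
rewrite le_eqVlt => /predU1P[->|ab] dF cf.
  by rewrite set_itv1 Rintegral_set1 subrr.
have cF : continuous F.
  by move=> x; apply: differentiable_continuous; apply/derivable1_diffP; have [] := dF x.
rewrite /Rintegral (@continuous_FTC2 _ f F)//.
- exact: continuous_subspaceT.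
- split.
  + by move=> x _; have [] := dF x.
  + exact: cvg_at_right_filter (cF a).
  + exact: cvg_at_left_filter (cF b).
- by move=> x _; rewrite derive1E; exact: derive_val.
Qed.

Definition tent_kernel n a x : R := n.+1%:R * tent (n.+1%:R * (x - a)).

Lemma tent_kernel_ge0 n a x : 0 <= tent_kernel n a x.
Proof. by rewrite mulr_ge0// tent_ge0. Qed.

Lemma tent_kernel_support n a x :
  tent_kernel n a x != 0 -> a <= x <= a + 2 / n.+1%:R.
Proof.
apply: contraNT; rewrite negb_and -!ltNge => /orP[xa|ax]; rewrite /tent_kernel.
- by rewrite tent0l ?mulr0// mulr_ge0_le0// subr_le0 ltW.
- rewrite tent0r ?mulr0//.
  by rewrite -ler_pdivrMl// mulrC lerBrDl ltW.
Qed.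

Lemma continuous_tent_kernel n a : continuous (tent_kernel n a).
Proof. exact: continuous_scaled_tent. Qed.

Lemma tent_kernel_integral n a :
  \int[mu]_(x in `[a, a + 2]) tent_kernel n a x = 1.
Proof.
rewrite (@C1_integral (fun x => step (n.+1%:R * (x - a))) (tent_kernel n a) _ _ _
  (fun x => is_derive_scaled_step _ _ x)).
- rewrite /= (subrr a) mulr0 (step0 (lexx 0)) subr0 step1//.
  by rewrite addrC addKr ler_peMl// ler1n.
- by rewrite lerDl.
- exact: continuous_tent_kernel.
Qed.

Lemma tent_kernel_restrict n a u :
  (fun x => (u x * tent_kernel n a x)%:E) =
  (fun x => (u x * tent_kernel n a x)%:E) \_ `[a, a + 2].
Proof.
apply/funext => x.
rewrite patchE; case: ifPn => // xa.
have [->|] := eqVneq (tent_kernel n a x) 0; first by rewrite mulr0.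
move=> /tent_kernel_support/andP[ax xn]; move: xa.
rewrite notin_setE/= in_itv/= ax/= (le_trans xn)//.
by rewrite lerD2l ler_pdivrMr// ler_peMr// ler1n.
Qed.

Lemma tent_kernel_itv n a u :
  (\int[mu]_x (u x * tent_kernel n a x)%:E =
  \int[mu]_(x in `[a, (a + 2)%R]) (u x * tent_kernel n a x)%:E)%E.
Proof. by rewrite [RHS]integral_mkcond -tent_kernel_restrict. Qed.

Lemma tent_kernel_integrable n a u : continuous u ->
  mu.-integrable `[a, a + 2] (EFin \o (fun x => u x * tent_kernel n a x)).
Proof.
move=> cu; apply: locally_integrable_itv; apply: continuous_locally_integrable.
by move=> x; apply: cvgM; [exact: cu|exact: continuous_tent_kernel].
Qed.

Lemma tent_kernel_integrableT n a u : continuous u ->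
  mu.-integrable setT (fun x => (u x * tent_kernel n a x)%:E).
Proof.
move=> cu; rewrite tent_kernel_restrict.
apply: (@integrable_mkcond _ _ _ mu _ _ _).1 => //.
exact: (tent_kernel_integrable n a cu).
Qed.

(** The kernels have integral 1 and are supported in [a, a + 2 / n.+1], so they
    average the continuous function [u] near [a]. *)
Lemma tent_kernel_cvg a u : continuous u ->
  \int[mu]_x (u x * tent_kernel n a x) @[n --> \oo] --> u a.
Proof.
move=> cu; apply/cvgrPdist_le => e e0.
have /cvgrPdist_le/(_ _ e0)[d/= d0 ud] := cu a.
near=> n.
rewrite /Rintegral tent_kernel_itv -/(Rintegral mu `[a, a + 2] _).
have cc : continuous (fun _ : R => u a) by exact: cst_continuous.
have iu := tent_kernel_integrable n a cu; have ic := tent_kernel_integrable n a cc.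
have ik : mu.-integrable `[a, a + 2] (EFin \o tent_kernel n a).
  by apply/locally_integrable_itv/continuous_locally_integrable/continuous_tent_kernel.
have E1 : u a = \int[mu]_(x in `[a, a + 2]) (u a * tent_kernel n a x).
  by rewrite RintegralZl// tent_kernel_integral mulr1.
rewrite [X in X - _]E1 -RintegralB//.
have ib : mu.-integrable `[a, a + 2]
    (EFin \o (fun x => u a * tent_kernel n a x - u x * tent_kernel n a x)).
  apply/locally_integrable_itv/continuous_locally_integrable => x.
  by apply: cvgB; (apply: cvgM; last exact: continuous_tent_kernel);
    [exact: cvg_cst|exact: cu].
apply: (le_trans (le_normr_Rintegral _ _)) => //.
have -> : e = \int[mu]_(x in `[a, a + 2]) (e * tent_kernel n a x).
  by rewrite RintegralZl// tent_kernel_integral mulr1.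
apply: le_Rintegral => //.
- exact: integrable_norm.
- by apply: eq_integrable (integrableZl _ e ik).
move=> x _; rewrite -mulrBl normrM (ger0_norm (tent_kernel_ge0 _ _ _)).
have [->|] := eqVneq (tent_kernel n a x) 0; first by rewrite !mulr0.
move=> /tent_kernel_support/andP[ax xn].
apply: ler_wpM2r; first exact: tent_kernel_ge0.
apply: ud => /=; rewrite distrC ger0_norm ?subr_ge0//.
rewrite ltrBlDl (le_lt_trans xn)// ltrD2l.
rewrite ltr_pdivrMr// mulrC -ltr_pdivrMr//.
apply: (@lt_trans _ _ n%:R); last by rewrite ltr_nat.
near: n; exact: nbhs_infty_gtr.
Unshelve. all: by end_near. Qed.

(** Absolute continuity with density [g], without reference to a base point. *)
Definition is_primitive g u := forall a b, a <= b ->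
  u b - u a = \int[mu]_(x in `[a, b]) g x.

(** A continuous representative is the integral of its weak derivative: test
    against smoothed indicators of [a, b], whose derivatives are the difference
    of two approximate identities. *)
Lemma weak_derivative_primitive u g : continuous u -> weak_derivative u g ->
  is_primitive g u.
Proof.
move=> cu [_ lg wug] a b; rewrite le_eqVlt => /predU1P[->|ab].
  by rewrite subrr set_itv1 Rintegral_set1.
(* Smoothed indicator of ]a, b], rising after [a] and falling after [b]. *)
pose phi n x := step (n.+1%:R * (x - a)) - step (n.+1%:R * (x - b)).
have dphi n x : is_derive x 1 (phi n) (tent_kernel n a x - tent_kernel n b x).
  have := is_derive_scaled_step n.+1%:R a x.
  have := is_derive_scaled_step n.+1%:R b x.
  exact: (fun h1 h2 => is_deriveB h2 h1).
have dphiE n : derive1 (phi n) = (fun x => tent_kernel n a x - tent_kernel n b x).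
  by apply/funext => x; rewrite derive1E; exact: derive_val.
have phi0 n x : phi n x != 0 -> a <= x <= b + 2.
  apply: contraNT; rewrite negb_and -!ltNge => /orP[xa|bx]; rewrite /phi.
    by rewrite !step0 ?subrr// mulr_ge0_le0// subr_le0 ltW// (lt_trans xa).
  have n1 : (1 : R) <= n.+1%:R by rewrite ler1n.
  by rewrite !step1 ?subrr//; nra.
have tphi n : test_function (phi n).
  split; first by move=> x; have [] := dphi n x.
    rewrite dphiE => x; apply: cvgB; exact: continuous_tent_kernel.
  apply: (@subclosed_compact _ _ `[a, b + 2]); [exact: closed_closure|
    exact: segment_compact|].
  rewrite [X in _ `<=` X](closure_id _).1; last exact: itv_closed.
  by apply: closure_subset => x/= /phi0; rewrite in_itv.
have phiE n : (\int[mu]_(x in `[a, (b + 2)%R]) (g x * phi n x)%:E =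
    - (\int[mu]_x (u x * tent_kernel n a x)
       - \int[mu]_x (u x * tent_kernel n b x))%:E)%E.
  rewrite integral_mkcond (_ : _ \_ _ = fun x => (g x * phi n x)%:E); last first.
    apply/funext => x; rewrite patchE; case: ifPn => // xab.
    have [->|/phi0 xab'] := eqVneq (phi n x) 0; first by rewrite mulr0.
    by move: xab; rewrite notin_setE/= in_itv/= xab'.
  rewrite -[LHS]oppeK -wug// dphiE.
  rewrite EFinB /Rintegral !fineK; last 2 first.
  - by apply: integrable_fin_num => //; exact: tent_kernel_integrableT.
  - by apply: integrable_fin_num => //; exact: tent_kernel_integrableT.
  congr (- _)%E; rewrite -integralB//; last 2 first.
  - exact: tent_kernel_integrableT.
  - exact: tent_kernel_integrableT.
  by apply: eq_integral => x _ /=; rewrite mulrBr EFinB.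
pose G x : \bar R := (g x * \1_(`]a, b]%classic) x)%:E.
have mg : measurable_fun setT g by case: lg.
have [_ _ cvG] : [/\ mu.-integrable `[a, (b + 2)%R] G,
    [sequence \int[mu]_(x in `[a, (b + 2)%R]) `|(g x * phi n x)%:E - G x|]_n @ \oo --> 0 &
    [sequence \int[mu]_(x in `[a, (b + 2)%R]) (g x * phi n x)%:E]_n @ \oo -->
      \int[mu]_(x in `[a, (b + 2)%R]) G x]%E.
  apply: (@dominated_convergence _ _ _ mu `[a, b + 2]%classic (measurable_itv _)
    (fun n x => (g x * phi n x)%:E) G (fun x => `|g x|%:E)) => //.
  - move=> n; apply/measurable_EFinP/measurable_funM; first exact: measurable_funTS.
    apply: measurable_funTS; apply: continuous_measurable_fun => x.
    by apply: differentiable_continuous; apply/derivable1_diffP; have [] := dphi n x.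
  - apply/measurable_EFinP/measurable_funM; first exact: measurable_funTS.
    by apply: measurable_funTS.
  - apply: aeW => x _; apply: cvg_EFin.
      exact: nearW.
    apply: cvgM; first exact: cvg_cst.
    have -> : \1_(`]a, b]%classic) x = (0 < x - a)%R%:R - (0 < x - b)%R%:R :> R.
      rewrite indicE mem_setE in_itv/= !subr_gt0.
      case: (ltP a x) => ax; case: (ltP b x) => bx//=; rewrite ?subrr ?subr0//.
      by have := lt_trans ab bx; rewrite ltNge ax.
    by apply: cvgB; exact: step_cvg.
  - exact: integrable_norm (locally_integrable_itv _ _ lg).
  - apply: aeW => x n _; rewrite lee_fin normrM ler_piMr//.
    have /andP[? ?] := step01 (n.+1%:R * (x - a)).
    by have /andP[? ?] := step01 (n.+1%:R * (x - b)); rewrite /phi ler_norml; lra.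
have iG : (\int[mu]_(x in `[a, (b + 2)%R]) G x = \int[mu]_(x in `[a, b]) (g x)%:E)%E.
  rewrite -[RHS]integral_itv_obnd_cbnd; last first.
    by apply/measurable_EFinP; exact: measurable_funTS.
  rewrite integral_mkcond [RHS]integral_mkcond; apply: eq_integral => x _.
  rewrite !patchE /G indicE !mem_setE !in_itv/=.
  have [ax/=|ax/=] := ltP a x; last by case: ifP; rewrite ?mulr0.
  have [xb/=|xb/=] := leP x b; last by case: ifP; rewrite ?mulr0.
  by rewrite (ltW ax) (le_trans xb) ?lerDl//= mulr1.
move: cvG; rewrite iG -(fineK (integrable_fin_num _ (locally_integrable_itv a b lg)))//.
under eq_fun do rewrite phiE.
move=> /fine_cvg; rewrite -/(Rintegral mu `[a, b] g) /comp/= => cvG.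
have cvu := cvgN (cvgB (@tent_kernel_cvg a u cu) (@tent_kernel_cvg b u cu)).
rewrite -opprB; apply: (cvg_unique _ _ cvG) => //; exact: cvu.
Qed.
End weak_derivative_primitive.

Section primitive_weak_derivative.
Context {R : realType}.
Notation mu := (@lebesgue_measure R).
Implicit Types (f g u v k F : R -> R) (a b x : R).

(** Provides the dominating function for Fubini's theorem below. *)
Lemma integrable_tensor f g :
  mu.-integrable setT (EFin \o f) -> mu.-integrable setT (EFin \o g) ->
  (mu \x mu)%E.-integrable setT (fun p : R * R => (f p.1 * g p.2)%:E).
Proof.
move=> fi gi.
have mf : measurable_fun setT f by case/integrableP: fi => /measurable_EFinP.
have mg : measurable_fun setT g by case/integrableP: gi => /measurable_EFinP.
apply/integrable12ltyP => /=.
  apply/measurable_EFinP/measurable_funM; exact: measurableT_comp.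
have cg : (\int[mu]_y `|(g y)%:E| < +oo)%E by case/integrableP: gi.
have cf : (\int[mu]_y `|(f y)%:E| < +oo)%E by case/integrableP: fi.
have mng : measurable_fun setT (fun y => `|g y|%:E).
  by apply/measurable_EFinP; exact: measurableT_comp.
have mnf : measurable_fun setT (fun y => `|f y|%:E).
  by apply/measurable_EFinP; exact: measurableT_comp.
under eq_integral => x _.
  under eq_integral do rewrite normrM EFinM.
  rewrite ge0_integralZl//; over.
rewrite ge0_integralZr//; last exact: integral_ge0.
by rewrite lte_mul_pinfty// ?integral_ge0// ge0_fin_numE// integral_ge0.
Qed.

Lemma compact_support_bound (phi : R -> R) :
  compact (closure [set x | phi x != 0]) ->
  exists2 N, 0 < N & forall x, N <= `|x| -> phi x = 0.
Proof.
move=> /compact_bounded/pinfty_ex_gt0[M M0 phiM].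
exists (M + 1); first by rewrite ltr_wpDl// ltW.
move=> x xM; apply: contraTeq xM => phix; rewrite -ltNge.
by rewrite (@le_lt_trans _ _ M) ?ltrDl//; apply: phiM; exact: subset_closure.
Qed.

Lemma derive1_outside_support (phi : R -> R) N x :
  (forall x, N <= `|x| -> phi x = 0) -> N < `|x| -> derive1 phi x = 0.
Proof.
move=> phi0 Nx; rewrite derive1E.
rewrite (@near_eq_derive _ _ _ phi (cst 0)) ?derive_cst//.
have cn : `|y| @[y --> x] --> `|x| by apply: norm_continuous.
near=> y; apply: phi0; apply/ltW; near: y.
exact: (cvgr_gt _ cn).
Unshelve. all: by end_near. Qed.

(** Integration by parts for an indefinite integral: exchange the order of
    integration in the triangle y <= x of the support of the test function. *)
Lemma primitive_weak_derivative g v : continuous v ->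
  locally_integrable setT g -> is_primitive g v -> weak_derivative v g.
Proof.
move=> cv lg vg; split => //; first exact: continuous_locally_integrable.
move=> phi [dphi cphi /compact_support_bound[N N0 phi0]].
pose psi := derive1 phi.
have dphi' x : is_derive x 1 phi (psi x).
  by split; [exact: dphi|rewrite /psi derive1E].
have psi0 x : N < `|x| -> psi x = 0 by exact: derive1_outside_support.
pose I := `[- N, N]%classic.
have mI : measurable I by exact: measurable_itv.
have mg : measurable_fun setT g by case: lg.
have mpsi : measurable_fun setT psi by exact: continuous_measurable_fun.
(* The first variable is the argument of [psi], the second that of [g]. *)
pose f (p : R * R) := if [&& - N <= p.2, p.2 <= p.1 & p.1 <= N] then
   psi p.1 * g p.2 else 0.
have mf : measurable_fun setT f.
  apply: measurable_fun_ifT.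
    by do 2?apply: measurable_and; apply: measurable_fun_ler;
      (apply: measurable_cst || apply: measurable_snd || apply: measurable_fst).
    by apply: measurable_funM; exact: measurableT_comp.
  exact: measurable_cst.
have intI h : locally_integrable setT h ->
    mu.-integrable setT (EFin \o (h \_ I)).
  move=> /(locally_integrable_itv (- N) N).
  rewrite -restrict_EFin => ih.
  by apply: (@integrable_mkcond _ _ _ mu _ _ _).1 => //.
have fi : (mu \x mu)%E.-integrable setT (EFin \o f).
  have it := integrable_tensor (intI _ (continuous_locally_integrable cphi)) (intI _ lg).
  apply: le_integrable it => //.
  - exact/measurable_EFinP.
  - move=> -[x y] _; rewrite /f /= lee_fin.
    case: ifPn => [/and3P[Ny yx xN]|]; last by rewrite normr0.
    have xI : x \in I by rewrite /I mem_setE in_itv/= xN (le_trans Ny yx).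
    have yI : y \in I by rewrite /I mem_setE in_itv/= Ny (le_trans yx xN).
    by rewrite !patchE xI yI.
have F1 x : (\int[mu]_y (EFin \o f) (x, y) =
    (((fun x => (v x - v (- N)) * psi x) \_ I) x)%:E)%E.
  rewrite patchE; case: ifPn => xI; last first.
    apply: integral0_eq => y _; rewrite /f/=; case: ifPn => // /and3P[Ny yx xN].
    by move: xI; rewrite /I mem_setE in_itv/= xN (le_trans Ny yx).
  move: xI; rewrite /I mem_setE in_itv/= => /andP[Nx xN].
  rewrite vg// mulrC /Rintegral.
  have ig := locally_integrable_itv (- N) x lg.
  rewrite EFinM fineK; last by apply: integrable_fin_num.
  rewrite -integralZl// [RHS]integral_mkcond; apply: eq_integral => y _.
  by rewrite patchE mem_setE in_itv/= /f/= xN andbT; case: ifP.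
have F2 y : (\int[mu]_x (EFin \o f) (x, y) = - (g y * phi y)%:E)%E.
  have [yI|yI] := boolP (- N <= y <= N); last first.
    rewrite phi0 ?mulr0; last first.
      by move: yI; rewrite -ler_norml -ltNge => /ltW.
    rewrite oppe0; apply: integral0_eq => x _; rewrite /f/=; case: ifPn => // /and3P[Ny yx xN].
    by move: yI; rewrite Ny (le_trans yx xN).
  move: yI => /andP[Ny yN].
  have ip : mu.-integrable `[y, N] (EFin \o psi).
    exact/locally_integrable_itv/continuous_locally_integrable.
  transitivity ((g y)%:E * \int[mu]_(x in `[y, N]) (psi x)%:E)%E.
    rewrite -integralZl// [RHS]integral_mkcond; apply: eq_integral => x _.
    by rewrite patchE mem_setE in_itv/= /f/= Ny/= mulrC; case: ifP.
  rewrite -(fineK (integrable_fin_num _ ip))//.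
  rewrite -/(Rintegral mu `[y, N] psi) (C1_integral yN dphi' cphi).
  by rewrite -EFinM -EFinN phi0 ?gtr0_norm// sub0r mulrN.
have := Fubini fi.
under eq_integral do rewrite F1.
under [in X in _ = X -> _]eq_integral do rewrite F2.
have gphi : mu.-integrable setT (fun y => (g y * phi y)%:E).
  have [C C0 phiC] : exists2 C, 0 <= C & forall y, `|phi y| <= C.
    have cphi0 : continuous phi.
      by move=> x; apply: differentiable_continuous; exact/derivable1_diffP.
    have /compact_bounded/pinfty_ex_gt0[C C0 phiC] : compact (phi @` I).
      by apply: (continuous_compact _ (@segment_compact _ _ _)); exact: continuous_subspaceT.
    exists C => [|y]; first exact: ltW.
    have [yN|Ny] := leP `|y| N; last by rewrite phi0 ?(ltW Ny)// normr0 ltW.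
    apply: phiC; exists y => //; rewrite /I/= in_itv/=. by rewrite -ler_norml.
  have /integrableP[mgI _] := intI g lg.
  apply: (@le_integrable _ _ _ mu _ _ _ (fun y => C%:E * (EFin \o (g \_ I)) y)%E) => //.
  - apply/measurable_EFinP/measurable_funM => //; apply: continuous_measurable_fun => x.
    by apply: differentiable_continuous; exact/derivable1_diffP.
  - move=> y _; rewrite /= lee_fin !normrM (ger0_norm C0) patchE.
    rewrite /I mem_setE in_itv/= -ler_norml.
    case: ifPn => [_|]; first by rewrite mulrC ler_wpM2r.
    by rewrite -ltNge => /ltW/phi0->; rewrite !normr0 !mulr0.
  - by apply: integrableZl => //; exact: intI.
rewrite integralN; last exact: integrable_add_def gphi.
move=> <-.
have lvpsi : mu.-integrable I (fun x => (v x * psi x)%:E).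
  apply: (@locally_integrable_itv R (fun x => v x * psi x)).
  by apply: continuous_locally_integrable => x; apply: cvgM; [exact: cv|exact: cphi].
have lpsi : mu.-integrable I (EFin \o psi).
  by apply: locally_integrable_itv; exact: continuous_locally_integrable.
transitivity (\int[mu]_(x in I) (v x * psi x)%:E)%E.
  rewrite [RHS]integral_mkcond; apply: eq_integral => x _.
  rewrite patchE; case: ifPn => //.
  rewrite /I mem_setE in_itv/= -ler_norml -ltNge => /psi0 px.
  by rewrite -/(psi x) px mulr0.
transitivity (\int[mu]_(x in I) ((v x * psi x)%:E - (v (- N))%:E * (psi x)%:E))%E.
  rewrite integralB//; last exact: integrableZl.
  rewrite integralZl//.
  have NN : - N <= N by rewrite (@le_trans _ _ 0) ?oppr_le0// ltW.
  rewrite -(fineK (integrable_fin_num _ lpsi))//.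
  rewrite -/(Rintegral mu I psi) (C1_integral NN dphi' cphi).
  by rewrite !phi0 ?normrN ?gtr0_norm// subrr mule0 sube0.
rewrite [LHS]integral_mkcond; apply: eq_integral => x _.
by rewrite !patchE; case: ifP => // _; rewrite mulrBl EFinB EFinM.
Qed.
End primitive_weak_derivative.

(** * Functions with dominated increments *)

Section radon_nikodym_sigma_finite_measures.
Local Open Scope ereal_scope.
Context d (T : measurableType d) (R : realType).
Variables (mu nu : {sigma_finite_measure set T -> \bar R}).

(** Sum the densities of the restrictions of [nu] to disjoint pieces of finite
    mass. *)
Lemma sigma_finite_density : nu `<< mu ->
  exists f : T -> \bar R, [/\ forall x, 0 <= f x, measurable_fun setT f &
    forall A, measurable A -> nu A = \int[mu]_(x in A) f x].
Proof.
move=> nu_mu; have [F TF /all_and2[mF nuFoo]] := sigma_finiteT nu.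
pose E := seqDU F.
have mE k : measurable (E k).
  by apply: measurableD => //; exact: bigsetU_measurable.
have nuEoo k : nu (E k) < +oo.
  by rewrite (le_lt_trans _ (nuFoo k))// le_measure ?inE//; exact: subDsetl.
have UET : \bigcup_i E i = [set: T] by rewrite TF [RHS]seqDU_bigcup_eq.
have tE : trivIset setT E := @trivIset_seqDU _ F.
pose nu_ j : {finite_measure set T -> \bar R} := mfrestr (mE j) (nuEoo j).
have nu_mu_ k : nu_ k `<< mu.
  apply/null_content_dominatesP => S mS muS0.
  move/null_content_dominatesP : nu_mu; apply; first exact: measurableI.
  apply/eqP; rewrite eq_le measure_ge0 andbT -muS0.
  by rewrite le_measure ?inE//; exact: measurableI.
have [g_ ] := choice (fun j => radon_nikodym_sigma_finite (nu_mu_ j)).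
move=> /all_and4[g0 gfin gi nug].
have mg j : measurable_fun setT (g_ j) by case/integrableP: (gi j).
exists (fun x => \sum_(j <oo) g_ j x); split.
- by move=> x; apply: nneseries_ge0.
- by apply: ge0_emeasurable_sum => //.
- move=> A mA; rewrite integral_nneseries//; last first.
    by move=> n; exact: measurable_funTS.
  transitivity (\sum_(j <oo) nu (A `&` E j)).
    have AE : \bigcup_j (A `&` E j) = A by rewrite -setI_bigcupr UET setIT.
    rewrite -[in LHS]AE measure_semi_bigcup ?AE//.
    + by move=> j; exact: measurableI.
    + exact: trivIset_setIl.
  by apply: eq_eseriesr => j _; rewrite -nug.
Qed.
End radon_nikodym_sigma_finite_measures.

Section density_measure.
Local Open Scope ereal_scope.
Context d (T : measurableType d) (R : realType).
Variables (mu : {measure set T -> \bar R}) (f : T -> \bar R).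
Hypotheses (f0 : forall x, 0 <= f x) (mf : measurable_fun setT f).

(** The proofs are arguments so that they can be recovered from the measure
    when its instance is inferred. *)
Definition density_measure of (forall x, 0 <= f x) & measurable_fun setT f :=
  fun A : set T => \int[mu]_(x in A) f x.

Let density0 : density_measure f0 mf set0 = 0.
Proof. exact: integral_set0. Qed.

Let density_ge0 A : 0 <= density_measure f0 mf A.
Proof. exact: integral_ge0. Qed.

Let density_sigma_additive : semi_sigma_additive (density_measure f0 mf).
Proof.
move=> F mF tF mUF; rewrite /density_measure ge0_integral_bigcup//; last first.
  exact: measurable_funTS.
by apply: is_cvg_ereal_nneg_natsum => n _; exact: integral_ge0.
Qed.

HB.instance Definition _ := isMeasure.Build _ _ _ (density_measure f0 mf)
  density0 density_ge0 density_sigma_additive.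
End density_measure.

Section absolutely_continuous.
Context {R : realType}.
Notation mu := (@lebesgue_measure R).
Implicit Types (f g u v k F : R -> R) (a b x : R).

Lemma Rintegral_chasles f a b c : locally_integrable setT f -> a <= b -> b <= c ->
  \int[mu]_(x in `[a, c]) f x =
  \int[mu]_(x in `[a, b]) f x + \int[mu]_(x in `[b, c]) f x.
Proof.
move=> lf ab bc.
have ik x y : mu.-integrable `[x, y] (EFin \o f) by exact: locally_integrable_itv.
have := @Rintegral_itvB _ f (BLeft a) (BRight c) b (ik a c).
rewrite !bnd_simp => /(_ ab bc); rewrite Rintegral_itv_obnd_cbnd.
  by move=> <-; rewrite subrKC.
by apply: integrableS (ik b c) => //; exact: subset_itv_oc_cc.
Qed.

(** Continuity at [x] follows from that of the integral from the base point
    [x - 1]. *)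
Lemma primitive_exists k : locally_integrable setT k ->
  exists2 K, continuous K & is_primitive k K.
Proof.
move=> lk.
have ik a b : mu.-integrable `[a, b] (EFin \o k) by exact: locally_integrable_itv.
have chasles a b c := @Rintegral_chasles k a b c lk.
pose K x := if 0 <= x then \int[mu]_(t in `[0, x]) k t
            else - \int[mu]_(t in `[x, 0]) k t.
have pK : is_primitive k K.
  move=> a b ab; rewrite /K.
  have [a0|a0] := leP 0 a; have [b0|b0] := leP 0 b.
  - by rewrite (chasles 0 a b)// addrC addKr.
  - by have := le_lt_trans (le_trans a0 ab) b0; rewrite ltxx.
  - by rewrite opprK addrC -chasles// ltW.
  - by rewrite opprK addrC (chasles a b 0)// ?(ltW b0)// addrK.
exists K => // x.
have := @parameterized_integral_continuous R (x - 1) (x + 1) k.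
have x1 : x - 1 < x + 1 by lra.
move=> /(_ (ltW x1) (ik _ _)) /(continuous_within_itvP _ x1)[+ _ _].
have xin : x \in `](x - 1), (x + 1)[ by rewrite in_itv/=; lra.
move=> /(_ x xin) cK.
have KE y : x - 1 <= y -> K (x - 1) + parameterized_integral mu (x - 1) y k = K y.
  by move=> xy; rewrite /parameterized_integral -pK// addrC subrK.
have cK' : K (x - 1) + parameterized_integral mu (x - 1) y k @[y --> x] --> K x.
  rewrite -[K x]KE; last lra.
  by apply: cvgD; [exact: cvg_cst|exact: cK].
apply: cvg_trans cK'; apply: near_eq_cvg; near=> y; apply: KE.
by apply/ltW; near: y; apply: lt_nbhsr; lra.
Unshelve. all: by end_near. Qed.

Lemma stieltjes_itv (F : cumulative R R) a b : a <= b ->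
  lebesgue_stieltjes_measure F `]a, b]%classic = (F b - F a)%:E.
Proof.
move=> ab; rewrite /lebesgue_stieltjes_measure /measure_extension.
by rewrite measurable_mu_extE/=; [rewrite wlength_itv_bnd|exact: is_ocitv].
Qed.

Lemma integral_itv_oc f a b : locally_integrable setT f ->
  (\int[mu]_(x in `]a, b]) (f x)%:E)%E = (\int[mu]_(x in `[a, b]) f x)%:E.
Proof.
move=> lf; have fi := locally_integrable_itv a b lf.
rewrite integral_itv_obnd_cbnd; last first.
  by apply/measurable_EFinP; apply: measurable_funTS; case: lf.
by rewrite /Rintegral fineK//; exact: integrable_fin_num.
Qed.

(** Let [K] be a primitive of [k].  Then [K + v] and [K - v] are nondecreasing
    and their Stieltjes measures add up to [2 k dx].  Hence that of [K + v] is
    absolutely continuous, and [v] is a primitive of its Radon-Nikodym density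
    minus [k]. *)
Lemma dominated_increments_primitive k v : continuous v ->
  locally_integrable setT k -> (forall x, 0 <= k x) ->
  (forall a b, a <= b -> `|v b - v a| <= \int[mu]_(x in `[a, b]) k x) ->
  exists2 g, locally_integrable setT g & is_primitive g v.
Proof.
move=> cv lk k0 vk.
have [K cK pK] := primitive_exists lk.
have ndA : nondecreasing (fun x => K x + v x).
  by move=> a b ab; have := vk _ _ ab; rewrite -pK// ler_norml; lra.
have ndN : nondecreasing (fun x => K x - v x).
  by move=> a b ab; have := vk _ _ ab; rewrite -pK// ler_norml; lra.
have rcA : right_continuous (fun x => K x + v x).
  by apply: right_continuousW => x; apply: cvgD; [exact: cK|exact: cv].
have rcN : right_continuous (fun x => K x - v x).
  by apply: right_continuousW => x; apply: cvgB; [exact: cK|exact: cv].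
pose iA := isCumulative.Build R _ R _ ndA rcA.
pose iN := isCumulative.Build R _ R _ ndN rcN.
pose A : cumulative R R := HB.pack (fun x => K x + v x) iA.
pose B : cumulative R R := HB.pack (fun x => K x - v x) iN.
pose iC := isCumulative.Build R _ R (fun x => 2 * K x).
have ndC : nondecreasing (fun x => 2 * K x).
  by move=> a b ab; have := ndA _ _ ab; have := ndN _ _ ab; lra.
have rcC : right_continuous (fun x => 2 * K x).
  by apply: right_continuousW => x; apply: cvgM; [exact: cvg_cst|exact: cK].
pose C : cumulative R R := HB.pack (fun x => 2 * K x) (iC ndC rcC).
have mk : measurable_fun setT k by case: lk.
have m2k : measurable_fun setT (fun x => (2 * k x)%:E).
  by apply/measurable_EFinP; apply: measurable_funM.
have k20 x : (0 <= (2 * k x)%:E)%E by rewrite lee_fin mulr_ge0.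
have CE S : measurable S -> lebesgue_stieltjes_measure C S =
    (lebesgue_stieltjes_measure A S + lebesgue_stieltjes_measure B S)%E.
  move=> mS; rewrite -measure_addE.
  apply: lebesgue_stieltjes_measure_unique => // _ [[a b] _ <-].
  have [ab|ba] := leP a b; last by rewrite /= set_itv_ge ?measure0// bnd_simp -leNgt ltW.
  refine (etrans _ (esym (measure_addE _ _ _))).
  transitivity ((A b - A a)%:E + (B b - B a)%:E)%E.
    by rewrite [LHS](stieltjes_itv C ab) -EFinD /=; congr EFin; lra.
  exact: (congr2 adde (esym (stieltjes_itv A ab)) (esym (stieltjes_itv B ab))).
have Ck S : measurable S -> lebesgue_stieltjes_measure C S =
    (\int[mu]_(x in S) (2 * k x)%:E)%E.
  move=> mS; rewrite -[RHS]/(density_measure mu k20 m2k S).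
  apply: lebesgue_stieltjes_measure_unique => // _ [[a b] _ <-].
  have [ab|ba] := leP a b; last by rewrite /= set_itv_ge ?measure0// bnd_simp -leNgt ltW.
  rewrite [LHS](stieltjes_itv C ab) /= /density_measure.
  under eq_integral do rewrite EFinM.
  rewrite ge0_integralZl//.
  - by rewrite integral_itv_oc// -pK// -EFinM; congr EFin; lra.
  - by apply/measurable_EFinP; exact: measurable_funTS.
  - by move=> x _; rewrite lee_fin.
have Amu : lebesgue_stieltjes_measure A `<< mu.
  apply: (null_content_dominatesP _ _).2 => Z mZ muZ0.
  have : lebesgue_stieltjes_measure C Z = 0%E.
    by rewrite Ck//; apply: null_set_integral => //; exact: measurable_funTS.
  rewrite CE// => /eqP; rewrite padde_eq0 ?measure_ge0//.
  by move=> /andP[/eqP].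
have [f [f0 mf Af]] := sigma_finite_density Amu.
have fab a b : a <= b -> (\int[mu]_(x in `[a, b]) f x)%E = (A b - A a)%:E.
  move=> ab; rewrite -integral_itv_obnd_cbnd; last exact: measurable_funTS.
  by rewrite -Af//; exact: stieltjes_itv.
have fi a b : mu.-integrable `[a, b] f.
  have [ab|ba] := leP a b; last first.
    by rewrite set_itv_ge; [exact: integrable_set0|rewrite bnd_simp -ltNge].
  apply/integrableP; split; first exact: measurable_funTS.
  by under eq_integral do rewrite gee0_abs//; rewrite fab// ltry.
have lf : locally_integrable setT (fine \o f).
  split.
  - exact: measurableT_comp.
  - exact: openT.
  - move=> Q _ cQ; have [M M0 QM] := pinfty_ex_gt0 (compact_bounded cQ).
    apply: (@le_lt_trans _ _ (\int[mu]_(x in `[(- M)%R, M]) `|f x|)%E); last first.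
      by case/integrableP: (fi (- M) M).
    apply: (@le_trans _ _ (\int[mu]_(x in Q) `|f x|)%E).
      apply: ge0_le_integral => //=.
      + exact: compact_measurable.
      + apply/measurable_EFinP; apply: measurable_funTS.
        by apply: measurableT_comp => //; exact: measurableT_comp.
      + by apply: measurable_funTS; exact: measurableT_comp.
      + by move=> x _; case: (f x) => [r| |]//=; rewrite normr0 leey.
    apply: ge0_subset_integral => //=.
    + exact: compact_measurable.
    + by apply: measurable_funTS; exact: measurableT_comp.
    + by move=> x Qx /=; rewrite in_itv/= -ler_norml; exact: QM.
(* [v] is the difference of [K + v], whose density is [f], and [K]. *)
exists (fun x => (fine \o f) x - k x); first exact: locally_integrableB.
move=> a b ab; rewrite RintegralB//; [|exact: locally_integrable_itv..].
rewrite -pK// /Rintegral (_ : (\int[mu]_(x in _) _)%E = (A b - A a)%:E).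
  by rewrite /A/=; lra.
rewrite -fab//; apply: ae_eq_integral => //.
- apply/measurable_EFinP; apply: measurable_funTS; by case: lf.
- exact: measurable_funTS.
- by apply: filterS (integrable_ae _ (fi a b)) => //= x fx abx; rewrite fineK// fx.
Qed.
End absolutely_continuous.

(** * Bounding the kinetic energy *)

Section kinetic.
Context {R : realType}.
Notation mu := (@lebesgue_measure R).
Implicit Types (f g h u v k F : R -> R) (a b x : R).

(** At a Lebesgue point, [h x] is the limit of the averages of [h] over
    [x, x + 1 / n]. *)
Lemma locally_integrable_ae_ge0 h : locally_integrable setT h ->
  (forall a b, a <= b -> 0 <= \int[mu]_(x in `[a, b]) h x) ->
  {ae mu, forall x, 0 <= h x}.
Proof.
move=> lh h0.
pose E x n := `[x, x + n.+1%:R^-1]%classic.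
have muE x n : mu (E x n) = (n.+1%:R^-1)%:E.
  by rewrite /E lebesgue_measure_itv/= lte_fin ltrDl invr_gt0 ltr0n -EFinD addrAC subrr add0r.
have nE x : nicely_shrinking x (E x).
  split=> [n|]; first exact: measurable_itv.
  have r0 n : 0 < (2 : R) / n.+1%:R by rewrite divr_gt0.
  exists (4, fun n => PosNum (r0 n)); split => //=.
  - by rewrite -[X in _ --> X](mulr0 (2 : R)); apply: cvgM; [exact: cvg_cst|exact: cvg_harmonic].
  - move=> n y; rewrite /E/= in_itv/= /ball/= => /andP[xy yn].
    rewrite ltr_norml; have : 0 < n.+1%:R^-1 :> R by rewrite invr_gt0.
    by move: (n.+1%:R^-1) xy yn => i xy yn i0; apply/andP; split; lra.
  - move=> n; rewrite lebesgue_measure_ball ?(ltW (r0 n))// muE -EFinM lee_fin.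
    by rewrite -mulr_natr; move: (n.+1%:R^-1) => i; lra.
have := lebesgue_differentiation lh.
apply: filterS; first exact: (ae_filter_ringOfSetsType mu).
move=> x hx.
rewrite -lee_fin; apply: cvge_ge (nice_lebesgue_differentiation nE lh hx).
near=> n.
rewrite mule_ge0//; first by rewrite inve_ge0.
have ih := locally_integrable_itv x (x + n.+1%:R^-1) lh.
rewrite -(fineK (integrable_fin_num _ ih))// lee_fin; apply: h0.
by rewrite lerDl invr_ge0.
Unshelve. all: by end_near. Qed.

Lemma primitive_ae_le g k v : locally_integrable setT g -> locally_integrable setT k ->
  is_primitive g v ->
  (forall a b, a <= b -> `|v b - v a| <= \int[mu]_(x in `[a, b]) k x) ->
  {ae mu, forall x, `|g x| <= k x}.
Proof.
move=> lg lk gv vk.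
have h1 : {ae mu, forall x, 0 <= k x - g x}.
  apply: locally_integrable_ae_ge0; first exact: locally_integrableB.
  move=> a b ab; rewrite RintegralB//; [|exact: locally_integrable_itv..].
  by rewrite subr_ge0 -gv// (le_trans _ (vk _ _ ab))// ler_norm.
have h2 : {ae mu, forall x, 0 <= k x + g x}.
  apply: locally_integrable_ae_ge0; first exact: locally_integrableD.
  move=> a b ab; rewrite RintegralD//; [|exact: locally_integrable_itv..].
  by rewrite -gv// -[v b - v a]opprK subr_ge0 (le_trans _ (vk _ _ ab))// -normrN ler_norm.
apply: filterS2 h1 h2; first exact: (ae_filter_ringOfSetsType mu).
by move=> x h1 h2; rewrite ler_norml; lra.
Qed.

(** [|k| <= k^2 + 1], and compact sets have finite measure. *)
Lemma square_integrable_locally k : measurable_fun setT k ->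
  (\int[mu]_x (k x ^+ 2)%:E < +oo)%E -> locally_integrable setT k.
Proof.
move=> mk k2; split => //; first exact: openT.
move=> K _ cK; have mK := compact_measurable cK.
have mk2 : measurable_fun setT (fun x => (k x ^+ 2)%:E).
  by apply/measurable_EFinP; exact: measurable_funX.
apply: (@le_lt_trans _ _ (\int[mu]_(x in K) ((k x ^+ 2)%:E + 1))%E).
  apply: ge0_le_integral => //=.
  - by apply/measurable_EFinP; apply: measurable_funTS; exact: measurableT_comp.
  - by apply: emeasurable_funD => //; exact: measurable_funTS.
  - move=> x _; rewrite -EFinD lee_fin ler_norml; nra.
rewrite ge0_integralD//; last 2 first.
  - by move=> x _; rewrite lee_fin sqr_ge0.
  - exact: measurable_funTS.
rewrite integral_cst// mul1e lte_add_pinfty//; last exact: compact_finite_measure.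
apply: le_lt_trans k2; apply: ge0_subset_integral => //.
by move=> x _; rewrite lee_fin sqr_ge0.
Qed.

Lemma norm2_sqr u : (norm2 u ^+ 2 = \int[mu]_x (u x ^+ 2)%:E)%E.
Proof.
rewrite /norm2 unlock /= poweR12_sqrt; last first.
  by apply: integral_ge0 => x _; rewrite lee_fin powR_ge0.
rewrite -expe2 sqr_sqrte; last by apply: integral_ge0 => x _; rewrite lee_fin powR_ge0.
apply: eq_integral => x _ /=.
by rewrite powR_mulrn// real_normK// num_real.
Qed.

Lemma wderivP u : (exists g, weak_derivative u g) -> weak_derivative u (wderiv u).
Proof. by move=> ex; exact: (xgetPex (fun=> 0) ex). Qed.

(** The chosen weak derivative need not be the density that was constructed, but
    [v] is a primitive of both, and any density is bounded by [k]. *)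
Lemma weak_derivative_dominated v k : continuous v ->
  measurable_fun setT k -> (forall x, 0 <= k x) ->
  (\int[mu]_x (k x ^+ 2)%:E < +oo)%E ->
  (forall a b, a <= b -> `|v b - v a| <= \int[mu]_(x in `[a, b]) k x) ->
  (exists g, weak_derivative v g) /\
  (\int[mu]_x (`|wderiv v x| ^+ 2)%:E <= \int[mu]_x (k x ^+ 2)%:E)%E.
Proof.
move=> cv mk k0 k2 vk.
have lk := square_integrable_locally mk k2.
have ex : exists g, weak_derivative v g.
  have [g lg gv] := dominated_increments_primitive cv lk k0 vk.
  by exists g; exact: primitive_weak_derivative.
split => //; have wv := wderivP ex; have [_ lw _] := wv.
have wk := primitive_ae_le lw lk (weak_derivative_primitive cv wv) vk.
apply: ae_ge0_le_integral => //.

- apply/measurable_EFinP; apply: measurable_funX; apply: measurableT_comp => //.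
  by case: lw.
- by move=> x _; rewrite lee_fin sqr_ge0.
- by apply/measurable_EFinP; exact: measurable_funX.
- apply: filterS wk; first exact: (ae_filter_ringOfSetsType mu).
  move=> x wk _; rewrite lee_fin.
  by rewrite lerXn2r// nnegrE.
Qed.
End kinetic.

(** * Layer-cake formulas *)

Section layer_cake.
Context {R : realType}.
Notation mu := (@lebesgue_measure R).
Implicit Types (rho : R -> R) (x y t : R).

Lemma ge0_integral_opp (f : R -> \bar R) : measurable_fun setT f ->
  (forall x, (0 <= f x)%E) -> (\int[mu]_x f (- x)%R = \int[mu]_x f x)%E.
Proof.
move=> mf f0.
transitivity (\int[pushforward mu (-%R : _ -> measurableTypeR R)]_x f x)%E.
  by rewrite ge0_integral_pushforward.
by apply: eq_measure_integral => A mA _; exact: lebesgue_measureN.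
Qed.

Lemma tonelli_swap (f : R -> R -> R) :
  measurable_fun setT (fun p : R * R => f p.1 p.2) -> (forall x y, 0 <= f x y) ->
  (\int[mu]_x \int[mu]_y (f x y)%:E = \int[mu]_y \int[mu]_x (f x y)%:E)%E.
Proof.
move=> mf f0; apply: (@fubini_tonelli _ _ _ _ _ mu mu (fun p : R * R => (f p.1 p.2)%:E)).
  exact/measurable_EFinP.
by move=> p; rewrite lee_fin.
Qed.

(** The indicator of the levels [0 <= t < x]: its integral in [t] is the positive
    part of [x], which turns moments into integrals of tails. *)
Definition layer t x : R := ((0 <= t) && (t < x))%:R.

Lemma layer_ge0 t x : 0 <= layer t x.
Proof. by rewrite ler0n. Qed.

Lemma measurable_layer d (T : measurableType d) (f g : T -> R) :
  measurable_fun setT f -> measurable_fun setT g ->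
  measurable_fun setT (fun p => layer (f p) (g p)).
Proof.
move=> mf mg; rewrite /layer.
rewrite (_ : (fun p => _) = fun p => if (0 <= f p) && (f p < g p) then 1 else 0); last first.
  by apply/funext => p; case: ifP.
apply: measurable_fun_ifT; [|exact: measurable_cst..].
by apply: measurable_and; [apply: measurable_fun_ler|apply: measurable_fun_ltr].
Qed.

Lemma layer_itv (x : R) (h : R -> R) :
  (\int[mu]_t (layer t x * h t)%:E = \int[mu]_(t in `[0%R, x[) (h t)%:E)%E.
Proof.
rewrite [RHS]integral_mkcond; apply: eq_integral => t _.
rewrite patchE mem_setE in_itv/= /layer.
by case: ifP; rewrite ?mul1r ?mul0r.
Qed.

Lemma integral_layer x : (\int[mu]_t (layer t x)%:E = (Num.max 0 x)%:E)%E.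
Proof.
have := layer_itv x (cst 1); under eq_integral do rewrite mulr1.
move=> ->; rewrite [LHS](@integral_cst _ _ _ mu _ (measurable_itv `[0, x[) 1%E) mul1e.
rewrite [LHS](lebesgue_measure_itv `[0, x[) /= lte_fin.
by case: ltP => x0; rewrite ?sube0.
Qed.

Lemma layer_min t x y : layer t x * layer t y = layer t (Num.min x y).
Proof.
rewrite /layer lt_min; case: (0 <= t); case: (t < x); case: (t < y) => /=;
  by rewrite ?mulr1 ?mulr0 ?mul0r.
Qed.

Definition tail rho t : R := \int[mu]_(y in `]t, +oo[) rho y.

Section density.
Variable rho : R -> R.
Hypotheses (mrho : measurable_fun setT rho) (rho0 : forall x, 0 <= rho x)
  (irho : (\int[mu]_x (rho x)%:E < +oo)%E).

Lemma density_integrable D : measurable D -> mu.-integrable D (EFin \o rho).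
Proof.
move=> mD; apply: (@integrableS _ _ _ mu setT) => //.
apply/integrableP; split; first exact/measurable_EFinP.
by under eq_integral do rewrite /= ger0_norm//.
Qed.

Lemma tailE t : ((tail rho t)%:E = \int[mu]_(y in `]t, +oo[) (rho y)%:E)%E.
Proof.
by rewrite /tail /Rintegral fineK//; apply: integrable_fin_num => //; exact: density_integrable.
Qed.

Lemma tail_ge0 t : 0 <= tail rho t.
Proof. exact: Rintegral_ge0. Qed.

(** Patching the tail by 0 on negative levels makes every integral range over
    the whole line, where Tonelli's theorem applies. *)
Lemma tail_layer t :
  (\int[mu]_y (layer t y * rho y)%:E = (((tail rho) \_ `[0, +oo[) t)%:E)%E.
Proof.
rewrite patchE mem_setE in_itv/= andbT; case: ifPn => t0.
  rewrite tailE [RHS]integral_mkcond; apply: eq_integral => y _.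
  rewrite patchE mem_setE in_itv/= andbT /layer t0/=.
  by case: ifP; rewrite ?mul1r ?mul0r.
by apply: integral0_eq => y _; rewrite /layer (negbTE t0) mul0r.
Qed.

Lemma measurable_tail : measurable_fun setT ((tail rho) \_ `[0, +oo[).
Proof.
apply/measurable_EFinP.
rewrite (_ : EFin \o _ = fubini_F mu (fun p : R * R => (layer p.1 p.2 * rho p.2)%:E)); last first.
  by apply/funext => t /=; rewrite -tail_layer.
apply: measurable_fun_fubini_tonelli_F => //.
apply/measurable_EFinP/measurable_funM; last exact: measurableT_comp.
exact: measurable_layer.
by move=> p; rewrite lee_fin mulr_ge0// layer_ge0.
Qed.

Lemma tail_moment :
  (\int[mu]_x (Num.max 0 x * rho x)%:E = \int[mu]_(t in `[0%R, +oo[) (tail rho t)%:E)%E.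
Proof.
transitivity (\int[mu]_x \int[mu]_t (layer t x * rho x)%:E)%E.
  apply: eq_integral => x _; rewrite EFinM -integral_layer.
  rewrite -ge0_integralZr//.
  - by apply/measurable_EFinP; exact: measurable_layer.
  - by move=> t _; rewrite lee_fin layer_ge0.
  - by rewrite lee_fin.
rewrite [LHS](@tonelli_swap (fun x t => layer t x * rho x)); last 2 first.
- apply/measurable_funM; last exact: measurableT_comp.
  exact: measurable_layer.
- by move=> *; rewrite mulr_ge0// layer_ge0.
rewrite [RHS]integral_mkcond; apply: eq_integral => t _.
by rewrite tail_layer !patchE; case: ifP.
Qed.

(** A level [t] is below [min x y] exactly when it is below [x] and below [y]
    ([layer_min]), so the integrals in [x] and [y] separate at fixed [t]. *)
Lemma tail_pair_moment :
  (\int[mu]_x \int[mu]_y (Num.max 0 (Num.min x y) * rho x * rho y)%:E =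
   \int[mu]_(t in `[0%R, +oo[) (tail rho t ^+ 2)%:E)%E.
Proof.
pose T := (tail rho) \_ `[0, +oo[.
have T0 t : 0 <= T t by rewrite /T patchE; case: ifP => // _; exact: tail_ge0.
transitivity (\int[mu]_x \int[mu]_t (layer t x * rho x * T t)%:E)%E.
  apply: eq_integral => x _.
  transitivity (\int[mu]_y \int[mu]_t (layer t x * rho x * (layer t y * rho y))%:E)%E.
    apply: eq_integral => y _.
    transitivity ((\int[mu]_t (layer t (Num.min x y))%:E) * (rho x * rho y)%:E)%E.
      by rewrite integral_layer -EFinM mulrA.
    rewrite -ge0_integralZr//.
    + apply: eq_integral => t _; rewrite -EFinM -layer_min.
      by congr EFin; ring.
    + by apply/measurable_EFinP; exact: measurable_layer.
    + by move=> t _; rewrite lee_fin layer_ge0.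
    + by rewrite lee_fin mulr_ge0.
  rewrite [LHS](@tonelli_swap (fun y t => layer t x * rho x * (layer t y * rho y)));
    last 2 first.
  - apply/measurable_funM; apply: measurable_funM.
    + exact: measurable_layer.
    + exact: measurable_cst.
    + exact: measurable_layer.
    + exact: measurableT_comp.
  - by move=> *; rewrite !mulr_ge0// layer_ge0.
  apply: eq_integral => t _ /=.
  under eq_integral do rewrite EFinM.
  rewrite ge0_integralZl//.
  + by rewrite tail_layer EFinM.
  + apply/measurable_EFinP/measurable_funM => //; exact: measurable_layer.
  + by move=> y _; rewrite lee_fin mulr_ge0// layer_ge0.
  + by rewrite lee_fin mulr_ge0// layer_ge0.
rewrite [LHS](@tonelli_swap (fun x t => layer t x * rho x * T t)); last 2 first.
- apply/measurable_funM.
    apply/measurable_funM; last exact: measurableT_comp.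
    exact: measurable_layer.
  by apply: measurableT_comp => //; exact: measurable_tail.
- by move=> *; rewrite !mulr_ge0// layer_ge0.
rewrite [RHS]integral_mkcond; apply: eq_integral => t _ /=.
under eq_integral do rewrite EFinM.
rewrite ge0_integralZr//.
- rewrite tail_layer -EFinM /T !patchE; case: ifP => //.
  by rewrite mulr0.
- apply/measurable_EFinP/measurable_funM => //; exact: measurable_layer.
- by move=> y _; rewrite lee_fin mulr_ge0// layer_ge0.
- by rewrite lee_fin.
Qed.
End density.
End layer_cake.

(** * The interaction energy in terms of tails *)

Section potential.
Context {R : realType}.
Notation mu := (@lebesgue_measure R).
Implicit Types (rho : R -> R) (x y t z : R) (f g : R -> R -> R).

(** This is [min |x| |y|] if [x] and [y] have the same sign and 0 otherwise
    ([min_norm_same_side]), written as a sum over the two half-lines so that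
    each term has a layer-cake formula. *)
Definition same_side x y : R :=
  Num.max 0 (Num.min x y) + Num.max 0 (Num.min (- x) (- y)).

Lemma same_side_ge0 x y : 0 <= same_side x y.
Proof. by rewrite addr_ge0// le_max lexx. Qed.

Lemma norm_max x : `|x| = Num.max 0 x + Num.max 0 (- x).
Proof. by rewrite /Num.max; case: (ger0P x) => ?; do 2!case: ltP => ?; lra. Qed.

Lemma same_sideN x y : same_side (- x) (- y) = same_side x y.
Proof. by rewrite /same_side !opprK addrC. Qed.

Lemma same_side_pos x y : 0 <= x -> 0 <= y -> same_side x y = Num.min x y.
Proof.
move=> x0 y0; rewrite /same_side max_r ?le_min ?x0// max_l ?addr0//.
by rewrite ge_min oppr_le0 x0.
Qed.

Lemma same_side_opp x y : 0 <= x -> y <= 0 -> same_side x y = 0.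
Proof.
move=> x0 y0; rewrite /same_side !max_l ?addr0// ge_min ?y0 ?orbT//.
by rewrite oppr_le0 x0.
Qed.

Lemma min_norm_same_side x y :
  (if 0 < x * y then Num.min `|x| `|y| else 0) = same_side x y.
Proof.
wlog x0 : x y / 0 <= x.
  move=> h; have [/h//|/ltW x0] := leP 0 x.
  by rewrite -same_sideN -(normrN x) -(normrN y) -mulrNN; apply: h; rewrite oppr_ge0.
have [y0|y0] := leP 0 y.
  rewrite same_side_pos// !ger0_norm//; case: ifPn => //.
  rewrite lt0r mulf_eq0 mulr_ge0// andbT negbK => /orP[]/eqP->.
    by rewrite min_l.
  by rewrite min_r.
rewrite same_side_opp ?(ltW y0)//; case: ifPn => //.
by rewrite ltNge mulr_ge0_le0// ltW.
Qed.

Lemma norm_sub_same_side x y : `|x - y| = `|x| + `|y| - 2 * same_side x y.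
Proof.
wlog x0 : x y / 0 <= x.
  move=> h; have [/h//|/ltW x0] := leP 0 x.
  have := h (- x) (- y); rewrite oppr_ge0 => /(_ x0).
  rewrite same_sideN !normrN => <-; rewrite -normrN; congr (`|_|); ring.
have [y0|y0] := leP 0 y.
  rewrite same_side_pos// (ger0_norm x0) (ger0_norm y0) /Num.min.
  by case: ltP => xy; [rewrite ltr0_norm|rewrite ger0_norm]; lra.
by rewrite same_side_opp ?(ltW y0)// (ger0_norm x0) (ltr0_norm y0) ger0_norm; lra.
Qed.

Lemma kernel_same_side z x y : z * (`|x| + `|y|) - `|x - y| =
  2 * ((z - 1) / 2 * `|x| + (z - 1) / 2 * `|y| + same_side x y).
Proof. by rewrite norm_sub_same_side; field. Qed.

Lemma measurable_section f x : measurable_fun setT (fun p : R * R => f p.1 p.2) ->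
  measurable_fun setT (f x).
Proof.
move=> mf; apply: (measurable_fun_pair2 (f := fun p : R * R => f p.1 p.2) x mf).
Qed.

Lemma measurable_inner_integral f :
  measurable_fun setT (fun p : R * R => f p.1 p.2) -> (forall x y, 0 <= f x y) ->
  measurable_fun setT (fun x => \int[mu]_y (f x y)%:E)%E.
Proof.
move=> mf f0.
apply: (@measurable_fun_fubini_tonelli_F _ _ _ _ _ mu (fun p : R * R => (f p.1 p.2)%:E)).
  exact/measurable_EFinP.
by move=> p; rewrite lee_fin.
Qed.

Lemma double_integralD f g :
  measurable_fun setT (fun p : R * R => f p.1 p.2) -> (forall x y, 0 <= f x y) ->
  measurable_fun setT (fun p : R * R => g p.1 p.2) -> (forall x y, 0 <= g x y) ->
  (\int[mu]_x \int[mu]_y (f x y + g x y)%:E =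
   \int[mu]_x \int[mu]_y (f x y)%:E + \int[mu]_x \int[mu]_y (g x y)%:E)%E.
Proof.
move=> mf f0 mg g0; rewrite -ge0_integralD//.
- apply: eq_integral => x _; rewrite -ge0_integralD//.
  + by move=> y _; rewrite lee_fin.
  + by apply/measurable_EFinP; exact: measurable_section.
  + by move=> y _; rewrite lee_fin.
  + by apply/measurable_EFinP; exact: measurable_section.
- by move=> x _; apply: integral_ge0 => y _; rewrite lee_fin.
- exact: measurable_inner_integral.
- by move=> x _; apply: integral_ge0 => y _; rewrite lee_fin.
- exact: measurable_inner_integral.
Qed.

Lemma double_integral_opp f :
  measurable_fun setT (fun p : R * R => f p.1 p.2) -> (forall x y, 0 <= f x y) ->
  (\int[mu]_x \int[mu]_y (f (- x)%R (- y)%R)%:E = \int[mu]_x \int[mu]_y (f x y)%:E)%E.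
Proof.
move=> mf f0.
transitivity (\int[mu]_x (fun x => \int[mu]_y (f x y)%:E) (- x)%R)%E.
  apply: eq_integral => x _.
  apply: (@ge0_integral_opp R (fun y => (f (- x) y)%:E)).
    by apply/measurable_EFinP; exact: measurable_section.
  by move=> y; rewrite lee_fin.
apply: ge0_integral_opp; first exact: measurable_inner_integral.
by move=> x; apply: integral_ge0 => y _; rewrite lee_fin.
Qed.

Lemma double_integralZ (c : R) f : 0 <= c ->
  measurable_fun setT (fun p : R * R => f p.1 p.2) -> (forall x y, 0 <= f x y) ->
  (\int[mu]_x \int[mu]_y (c * f x y)%:E = c%:E * \int[mu]_x \int[mu]_y (f x y)%:E)%E.
Proof.
move=> c0 mf f0; rewrite -ge0_integralZl//.
- apply: eq_integral => x _; rewrite -ge0_integralZl//.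
  + by apply/measurable_EFinP; exact: measurable_section.
  + by move=> y _; rewrite lee_fin.
- exact: measurable_inner_integral.
- by move=> x _; apply: integral_ge0 => y _; rewrite lee_fin.
Qed.

Section charge_density.
Variable rho : R -> R.
Hypotheses (mrho : measurable_fun setT rho) (rho0 : forall x, 0 <= rho x)
  (irho : (\int[mu]_x (rho x)%:E < +oo)%E).

Let orho x := rho (- x).
Let morho : measurable_fun setT orho.
Proof. exact: measurableT_comp. Qed.

Let orho0 x : 0 <= orho x. Proof. exact: rho0. Qed.

Let iorho : (\int[mu]_x (orho x)%:E < +oo)%E.
Proof.
rewrite (@ge0_integral_opp R (EFin \o rho))//; exact/measurable_EFinP.
Qed.

Let mmax d (T : measurableType d) (h : T -> R) : measurable_fun setT h ->
  measurable_fun setT (fun p => Num.max 0 (h p)).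
Proof. by move=> mh; apply: measurable_maxr. Qed.

Let mmaxmin : measurable_fun setT (fun p : R * R => Num.max 0 (Num.min p.1 p.2)).
Proof. by apply: mmax; apply: measurable_minr. Qed.

(** The tails of [rho] at [+oo] and, through the reflection, at [-oo]. *)
Definition self_energy : \bar R :=
  (\int[mu]_(t in `[0%R, +oo[) (tail rho t ^+ 2)%:E +
   \int[mu]_(t in `[0%R, +oo[) (tail (fun x => rho (- x)%R) t ^+ 2)%:E)%E.

Lemma same_side_energy :
  (\int[mu]_x \int[mu]_y (same_side x y * rho x * rho y)%:E = self_energy)%E.
Proof.
rewrite /same_side; under eq_integral do under eq_integral do rewrite !mulrDl.
rewrite double_integralD.
- rewrite tail_pair_moment//; congr (_ + _)%E.
  rewrite -[RHS](tail_pair_moment morho orho0 iorho).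
  rewrite -[RHS](@double_integral_opp (fun x y => Num.max 0 (Num.min x y) * orho x * orho y)).
  + by rewrite /orho; under [RHS]eq_integral do under eq_integral do rewrite !opprK.
  + apply: measurable_funM; last exact: measurableT_comp.
    by apply: measurable_funM; last exact: measurableT_comp.
  + by move=> x y; rewrite !mulr_ge0// le_max lexx.
- apply: measurable_funM; last exact: measurableT_comp.
  by apply: measurable_funM; last exact: measurableT_comp.
- by move=> x y; rewrite !mulr_ge0// le_max lexx.
- apply: measurable_funM; last exact: measurableT_comp.
  apply: measurable_funM; last exact: measurableT_comp.
  by apply: mmax; apply: measurable_minr; exact: measurableT_comp.
- by move=> x y; rewrite !mulr_ge0// le_max lexx.
Qed.

Lemma same_side_energy_prod :
  (\int[mu \x mu]_(p in [set p : R * R | (0 < p.1 * p.2)%R])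
    (Num.min `|p.1| `|p.2| * rho p.1 * rho p.2)%:E = self_energy)%E.
Proof.
rewrite -same_side_energy integral_mkcond.
rewrite -(@fubini_tonelli1 _ _ _ _ _ mu mu
   (fun p : R * R => (same_side p.1 p.2 * rho p.1 * rho p.2)%:E)).
- apply: eq_integral => -[x y] _; rewrite patchE -min_norm_same_side/=.
  case: ifPn => [/set_mem/= -> //|].
  by rewrite notin_setE/= => /negP/negbTE ->; rewrite !mul0r.
- apply/measurable_EFinP.
  apply: measurable_funM; last exact: measurableT_comp.
  apply: measurable_funM; last exact: measurableT_comp.
  apply: measurable_funD => //.
  by apply: mmax; apply: measurable_minr; exact: measurableT_comp.
- by move=> p; rewrite lee_fin !mulr_ge0// same_side_ge0.
Qed.

Lemma self_energyE : (self_energy = \int[mu]_(t in `[0%R, +oo[)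
  (tail rho t ^+ 2 + tail (fun x => rho (- x)%R) t ^+ 2)%:E)%E.
Proof.
rewrite /self_energy -ge0_integralD//.
- by move=> t _; rewrite lee_fin sqr_ge0.
- apply/measurable_EFinP; apply: measurable_funX.
  by apply/(measurable_restrictT _ _).2 => //; exact: measurable_tail.
- by move=> t _; rewrite lee_fin sqr_ge0.
- apply/measurable_EFinP; apply: measurable_funX.
  by apply/(measurable_restrictT _ _).2 => //; exact: measurable_tail.
Qed.

Lemma norm_moment :
  (\int[mu]_x (`|x| * rho x)%:E =
   \int[mu]_(t in `[0%R, +oo[) (tail rho t)%:E +
   \int[mu]_(t in `[0%R, +oo[) (tail (fun x => rho (- x)%R) t)%:E)%E.
Proof.
rewrite -tail_moment// -tail_moment//.
rewrite -[X in (_ + X)%E](@ge0_integral_opp R (fun x => (Num.max 0 x * orho x)%:E)).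
- rewrite -ge0_integralD//.
  + by apply: eq_integral => x _; rewrite norm_max mulrDl /orho opprK.
  + by move=> x _; rewrite lee_fin mulr_ge0// le_max lexx.
  + by apply/measurable_EFinP; apply: measurable_funM => //; exact: mmax.
  + by move=> x _; rewrite lee_fin mulr_ge0// le_max lexx.
  + apply/measurable_EFinP; apply: measurable_funM.
      by apply: mmax; exact: oppr_measurable.
    by apply: measurableT_comp => //; exact: oppr_measurable.
- by apply/measurable_EFinP; apply: measurable_funM => //; exact: mmax.
- by move=> x; rewrite lee_fin mulr_ge0// le_max lexx.
Qed.

Lemma potential_energy z : 1 <= z -> (\int[mu]_x (rho x)%:E = 1)%E ->
  ((2^-1)%:E * \int[mu]_x \int[mu]_y
     ((z * (`|x| + `|y|) - `|x - y|) * rho x * rho y)%:E =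
   (z - 1)%:E * \int[mu]_x (`|x| * rho x)%:E + self_energy)%E.
Proof.
move=> z1 rho1.
have c0 : 0 <= (z - 1) / 2 by rewrite divr_ge0// subr_ge0.
have mn d (T : measurableType d) (h : T -> R) : measurable_fun setT h ->
    measurable_fun setT (fun p => `|h p|) by move=> mh; exact: measurableT_comp.
pose F1 x y := (z - 1) / 2 * (`|x| * rho x) * rho y.
pose F3 x y := same_side x y * rho x * rho y.
have kE x y : (z * (`|x| + `|y|) - `|x - y|) * rho x * rho y =
    2 * (F1 x y + F1 y x + F3 x y).
  by rewrite kernel_same_side /F1 /F3; ring.
have F10 x y : 0 <= F1 x y by rewrite /F1 mulr_ge0// mulr_ge0// mulr_ge0.
have F30 x y : 0 <= F3 x y by rewrite !mulr_ge0// same_side_ge0.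
have mF1 : measurable_fun setT (fun p : R * R => F1 p.1 p.2).
  apply: measurable_funM; last exact: measurableT_comp.
  apply: measurable_funM; first exact: measurable_cst.
  by apply: measurable_funM; [exact: mn|exact: measurableT_comp].
have mF1' : measurable_fun setT (fun p : R * R => F1 p.2 p.1).
  apply: measurable_funM; last exact: measurableT_comp.
  apply: measurable_funM; first exact: measurable_cst.
  by apply: measurable_funM; [exact: mn|exact: measurableT_comp].
have mF3 : measurable_fun setT (fun p : R * R => F3 p.1 p.2).
  apply: measurable_funM; last exact: measurableT_comp.
  apply: measurable_funM; last exact: measurableT_comp.
  apply: measurable_funD => //.
  by apply: mmax; apply: measurable_minr; exact: measurableT_comp.
have iF1 : (\int[mu]_x \int[mu]_y (F1 x y)%:E =
    ((z - 1) / 2)%:E * \int[mu]_x (`|x| * rho x)%:E)%E.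
  rewrite -ge0_integralZl//.
  - apply: eq_integral => x _; under eq_integral do rewrite EFinM.
    rewrite ge0_integralZl//.
    + by rewrite rho1 mule1.
    + exact/measurable_EFinP.
    + by move=> y _; rewrite lee_fin.
    + by rewrite lee_fin mulr_ge0// mulr_ge0.
  - by apply/measurable_EFinP; apply: measurable_funM => //; exact: mn.
  - by move=> x _; rewrite lee_fin mulr_ge0.
under eq_integral do under eq_integral do rewrite kE.
rewrite [X in (_ * X)%E](@double_integralZ 2 (fun x y => F1 x y + F1 y x + F3 x y))//; last 2 first.
- by apply: measurable_funD => //; apply: measurable_funD.
- by move=> x y; rewrite !addr_ge0.
rewrite muleA -EFinM mulVf// mul1e.
rewrite (@double_integralD (fun x y => F1 x y + F1 y x) F3)//; last 2 first.
- exact: measurable_funD.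
- by move=> x y; rewrite addr_ge0.
rewrite (@double_integralD F1 (fun x y => F1 y x))// -(@tonelli_swap R F1)//.
rewrite same_side_energy iF1 -ge0_muleDl; [|by rewrite lee_fin..].
by rewrite -EFinD -splitr.
Qed.
End charge_density.
End potential.

(** * Comparison of the minimiser with a competitor *)

Section comparison.
Context {R : realType}.
Notation mu := (@lebesgue_measure R).
Implicit Types (u v k : R -> R) (x y t z : R).

(** The increments of [v] are bounded by those of the continuous primitive of
    [k]. *)
Lemma dominated_increments_continuous v k : locally_integrable setT k ->
  (forall a b, a <= b -> `|v b - v a| <= \int[mu]_(x in `[a, b]) k x) ->
  continuous v.
Proof.
move=> lk vk x; have [K cK pK] := primitive_exists lk.
have vK a b : `|v b - v a| <= `|K b - K a|.
  wlog ab : a b / a <= b.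
    by move=> h; have [/h//|/ltW/h] := leP a b; rewrite distrC (distrC (K a)).
  by rewrite pK// (le_trans (vk _ _ ab))// ler_norm.
apply/cvgrPdist_le => e e0.
have /cvgrPdist_le/(_ _ e0) := cK x.
apply: filterS => y; apply: le_trans; exact: vK.
Qed.

Definition sq u x := u x ^+ 2.

Definition kinetic u : \bar R := (\int[mu]_x (`|wderiv u x| ^+ 2)%:E)%E.

Lemma kineticE u : kinetic u = (norm2 (wderiv u) ^+ 2)%E.
Proof.
by rewrite norm2_sqr; apply: eq_integral => x _; rewrite real_normK// num_real.
Qed.

Lemma norm2_eq1 u : norm2 u = 1%E <-> (\int[mu]_x (sq u x)%:E = 1)%E.
Proof.
split=> [u1|u1]; first by rewrite -norm2_sqr u1 expe2 mule1.
have := norm2_sqr u; rewrite [X in _ = X]u1 => nu.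
have n0 : (0 <= norm2 u)%E by exact: Lnorm_ge0.
move: n0 nu; case: (norm2 u) => [r| |]//.
- rewrite lee_fin expe2 -EFinM => r0 [r1]; congr EFin.
  by apply/eqP; rewrite -(@eqrXn2 _ 2)// expr1n expr2 r1.
Qed.

Lemma measurable_sq u : continuous u -> measurable_fun setT (sq u).
Proof. by move=> cu; apply: measurable_funX; exact: continuous_measurable_fun. Qed.

Lemma sq_ge0 u x : 0 <= sq u x. Proof. exact: sqr_ge0. Qed.

Lemma energyE z u : 1 <= z -> continuous u -> norm2 u = 1%E ->
  (energy z u = kinetic u + ((z - 1)%:E * \int[mu]_x (`|x| * sq u x)%:E
    + self_energy (sq u)))%E.
Proof.
move=> z1 cu /norm2_eq1 u1; rewrite /energy; congr (_ + _)%E.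
rewrite -potential_energy//.
- exact: measurable_sq.
- exact: sq_ge0.
- by rewrite u1 ltry.
Qed.

Definition tails u t := tail (sq u) t ^+ 2 + tail (fun x => sq u (- x)) t ^+ 2.

Definition tails1 u t := tail (sq u) t + tail (fun x => sq u (- x)) t.

Section normalised.
Variable u : R -> R.
Hypotheses (cu : continuous u) (u1 : (\int[mu]_x (sq u x)%:E = 1)%E).

Let msu := measurable_sq cu.
Let isu : (\int[mu]_x (sq u x)%:E < +oo)%E. Proof. by rewrite u1 ltry. Qed.
Let mosu : measurable_fun setT (fun x => sq u (- x)).
Proof. exact: measurableT_comp. Qed.

Lemma sq_oppE : (\int[mu]_x (sq u (- x)%R)%:E = 1)%E.
Proof.
by rewrite (@ge0_integral_opp R (EFin \o sq u)); [exact: u1|exact/measurable_EFinP|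
  move=> x; rewrite lee_fin sq_ge0].
Qed.

Let iosu : (\int[mu]_x (sq u (- x)%R)%:E < +oo)%E. Proof. by rewrite sq_oppE ltry. Qed.

Lemma self_energy_tails : (self_energy (sq u) =
  \int[mu]_(t in `[0%R, +oo[) (tails u t)%:E)%E.
Proof. by rewrite self_energyE//; exact: sq_ge0. Qed.

Lemma calB_self_energy :
  (\int[mu \x mu]_(p in [set p : R * R | (0 < p.1 * p.2)%R])
    (Num.min `|p.1| `|p.2| * u p.1 ^+ 2 * u p.2 ^+ 2)%:E = self_energy (sq u))%E.
Proof. by apply: same_side_energy_prod => // x; exact: sq_ge0. Qed.

Lemma moment_tails : (\int[mu]_x (`|x| * sq u x)%:E =
  \int[mu]_(t in `[0%R, +oo[) (tails1 u t)%:E)%E.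
Proof.
rewrite norm_moment//; last exact: sq_ge0.
rewrite -ge0_integralD//.
- by move=> t _; rewrite lee_fin; apply: tail_ge0 => x; exact: sq_ge0.
- apply/measurable_EFinP; apply/(measurable_restrictT _ _).2 => //.
  by apply: measurable_tail => // x; exact: sq_ge0.
- by move=> t _; rewrite lee_fin; apply: tail_ge0 => x; exact: sq_ge0.
- apply/measurable_EFinP; apply/(measurable_restrictT _ _).2 => //.
  by apply: measurable_tail => // x; exact: sq_ge0.
Qed.

Lemma tails_ge0 t : 0 <= tails u t.
Proof. by rewrite addr_ge0// sqr_ge0. Qed.

Lemma tails1_ge0 t : 0 <= tails1 u t.
Proof. by rewrite addr_ge0//; apply: tail_ge0 => x; exact: sq_ge0. Qed.

Lemma measurable_tails : measurable_fun (`[0, +oo[%classic : set R) (tails u).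
Proof.
apply: measurable_funD; apply: measurable_funX; apply/(measurable_restrictT _ _).2 => //;
  by apply: measurable_tail => // x; exact: sq_ge0.
Qed.

Lemma measurable_tails1 : measurable_fun (`[0, +oo[%classic : set R) (tails1 u).
Proof.
apply: measurable_funD; apply/(measurable_restrictT _ _).2 => //;
  by apply: measurable_tail => // x; exact: sq_ge0.
Qed.

(** Tails of a density of mass 1 are at most 1.  Thus the space X, on which the
    linear part is finite, has finite self-energy. *)
Lemma tails_le_tails1 t : tails u t <= tails1 u t.
Proof.
have tail1 (r : R -> R) : measurable_fun setT r -> (forall x, 0 <= r x) ->
    (\int[mu]_x (r x)%:E = 1)%E -> tail r t <= 1.
  move=> mr r0 r1; rewrite -lee_fin tailE//; last by rewrite r1 ltry.
  rewrite -[leRHS]r1; apply: ge0_subset_integral => //.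
    exact/measurable_EFinP.
  by move=> x _; rewrite lee_fin.
have t0 (r : R -> R) : (forall x, 0 <= r x) -> 0 <= tail r t by move=> r0; exact: tail_ge0.
have sq1 (r : R) : 0 <= r -> r <= 1 -> r ^+ 2 <= r by move=> ? ?; nra.
apply: lerD; apply: sq1.
- by apply: t0 => x; exact: sq_ge0.
- by apply: tail1 => // x; exact: sq_ge0.
- by apply: t0 => x; exact: sq_ge0.
- by apply: tail1 => // [x|]; [exact: sq_ge0|exact: sq_oppE].
Qed.
End normalised.

Lemma ae_eq_of_integral_le (D : set R) (f g : R -> R) : measurable D ->
  measurable_fun D f -> measurable_fun D g -> (forall x, D x -> 0 <= f x) ->
  (forall x, D x -> f x <= g x) -> (\int[mu]_(x in D) (g x)%:E < +oo)%E ->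
  (\int[mu]_(x in D) (g x)%:E <= \int[mu]_(x in D) (f x)%:E)%E ->
  {ae mu, forall x, D x -> f x = g x}.
Proof.
move=> mD mf mg f0 fg gfin gf.
have ig : mu.-integrable D (EFin \o g).
  apply/integrableP; split; first exact/measurable_EFinP.
  apply: le_lt_trans gfin; rewrite le_eqVlt; apply/orP; left; apply/eqP.
  apply: eq_integral => x /set_mem Dx /=.
  by rewrite ger0_norm// (le_trans (f0 _ Dx))// fg.
have jf : mu.-integrable D (EFin \o f).
  apply: le_integrable ig => //; first exact/measurable_EFinP.
  move=> x Dx /=; rewrite lee_fin !ger0_norm//; first exact: fg.
    by rewrite (le_trans (f0 _ Dx))// fg.
  exact: f0.
have h0 : (\int[mu]_(x in D) `|(EFin \o g) x - (EFin \o f) x| = 0)%E.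
  transitivity (\int[mu]_(x in D) ((EFin \o g) \- (EFin \o f)) x)%E.
    by apply: eq_integral => x /set_mem Dx /=; rewrite ger0_norm// subr_ge0 fg.
  rewrite integralB//; apply/eqP; rewrite eq_le; apply/andP; split.
    by rewrite sube_le0.
  rewrite sube_ge0 ?integrable_fin_num//; apply: le_integral => // x /set_mem Dx.
  by rewrite lee_fin fg.
have := (ae_eq_integral_abs mu mD (f := fun x => ((EFin \o g) x - (EFin \o f) x)%E) _).1 h0.
have mgf : measurable_fun D (fun x => ((EFin \o g) x - (EFin \o f) x)%E).
  by apply: emeasurable_funB; exact/measurable_EFinP.
move=> /(_ mgf); apply: filterS => x h Dx; have /= := h Dx; rewrite -EFinB => -[] /eqP.
by rewrite subr_eq0 => /eqP.
Qed.

(** The kinetic energy of [v] is at most that of [u] by domination by [k], and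
    the linear part of its potential energy by the bound on [tails1].  So
    minimality makes the integral of [tails u] at most that of [tails v]; as
    these are finite and the integrands are ordered, they agree.  The bound on
    [tails1] also gives membership in the space X when [z > 1], the bound on
    [tails] membership in B when [z = 1]. *)
Lemma minimiser_tails z u v k :
  1 <= z -> (1 < z -> minimiser (energy z) (@calX1 R) u) ->
  (z = 1 -> minimiser (energy z) (@calB1 R) u) ->
  measurable_fun setT k -> (forall x, 0 <= k x) ->
  (\int[mu]_x (k x ^+ 2)%:E <= kinetic u)%E ->
  (forall a b, a <= b -> `|v b - v a| <= \int[mu]_(x in `[a, b]) k x) ->
  (\int[mu]_x (sq v x)%:E = 1)%E ->
  (forall t, 0 <= t -> tails1 v t <= tails1 u t) ->
  (forall t, 0 <= t -> tails v t <= tails u t) ->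
  {ae mu, forall t, 0 <= t -> tails v t = tails u t}.
Proof.
move=> z1 hX hB mk k0 ku vk v1 tv1 tv.
have [Hu u1n] : H1 u /\ norm2 u = 1%E.
  by move: z1; rewrite le_eqVlt => /predU1P[/esym/hB|/hX] [[[? _] ?] _].
have [cu _ fu] := Hu.
have u1 := (norm2_eq1 u).1 u1n; have v1n := (norm2_eq1 v).2 v1.
have kinu : (kinetic u < +oo)%E.
  apply: le_lt_trans fu; rewrite kineticE leeDl//; exact: sqre_ge0.
have k2 : (\int[mu]_x (k x ^+ 2)%:E < +oo)%E by exact: le_lt_trans kinu.
have cv : continuous v.
  apply: (@dominated_increments_continuous v k) => //.
  exact: square_integrable_locally.
have [exv kv] := weak_derivative_dominated cv mk k0 k2 vk.
have kinv : (kinetic v <= kinetic u)%E by exact: le_trans ku.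
have Hv : H1 v.
  split; [exact: cv|exact: exv|].
  rewrite -kineticE v1n expe2 mule1; apply: lte_add_pinfty; last exact: ltry.
  exact: le_lt_trans kinu.
have Mvu : (\int[mu]_x (`|x| * sq v x)%:E <= \int[mu]_x (`|x| * sq u x)%:E)%E.
  rewrite (moment_tails cv v1) (moment_tails cu u1); apply: ge0_le_integral => //.
  - by move=> t _; rewrite lee_fin tails1_ge0.
  - by apply/measurable_EFinP; exact: measurable_tails1.
  - by apply/measurable_EFinP; exact: measurable_tails1.
  - by move=> t; rewrite /= in_itv/= andbT lee_fin => /tv1.
have Dvu : (self_energy (sq v) <= self_energy (sq u))%E.
  rewrite (self_energy_tails cv v1) (self_energy_tails cu u1).
  apply: ge0_le_integral => //.
  - by move=> t _; rewrite lee_fin tails_ge0.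
  - by apply/measurable_EFinP; exact: measurable_tails.
  - by apply/measurable_EFinP; exact: measurable_tails.
  - by move=> t; rewrite /= in_itv/= andbT lee_fin => /tv.
have DMu : (self_energy (sq u) <= \int[mu]_x (`|x| * sq u x)%:E)%E.
  rewrite (self_energy_tails cu u1) (moment_tails cu u1); apply: ge0_le_integral => //.
  - by move=> t _; rewrite lee_fin tails_ge0.
  - by apply/measurable_EFinP; exact: measurable_tails.
  - by apply/measurable_EFinP; exact: measurable_tails1.
  - by move=> t _; rewrite lee_fin tails_le_tails1.
have [zMu Du Euv] : [/\ ((z - 1)%:E * \int[mu]_x (`|x| * sq u x)%:E \is a fin_num)%E,
    (self_energy (sq u) < +oo)%E & (energy z u <= energy z v)%E].
  have M0 : (0 <= \int[mu]_x (`|x| * sq u x)%:E)%E.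
    by apply: integral_ge0 => x _; rewrite lee_fin mulr_ge0// sq_ge0.
  move: (z1); rewrite le_eqVlt => /predU1P[/esym/[dup] z1' /hB|/hX].
    move=> [[[_ Bu] _] minu]; split.
    - by rewrite z1' subrr mul0e.
    - by rewrite -calB_self_energy.
    - apply: minu; split; last exact: v1n.
      split; first exact: Hv.
      rewrite calB_self_energy//; apply: le_lt_trans Dvu _.
      by rewrite -calB_self_energy.
  move=> [[[_ Xu] _] minu]; split.
  - by rewrite fin_numM// ge0_fin_numE.
  - exact: le_lt_trans Xu.
  - apply: minu; split; last exact: v1n.
    split; [exact: Hv|exact: le_lt_trans Xu].
have Duv : (self_energy (sq u) <= self_energy (sq v))%E.
  move: Euv; rewrite (energyE z1 cu u1n) (energyE z1 cv v1n) => Euv.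
  have kuf : kinetic u \is a fin_num.
    by rewrite ge0_fin_numE//; apply: integral_ge0 => x _; rewrite lee_fin sqr_ge0.
  rewrite -(leeD2lE _ _ zMu) -(leeD2lE _ _ kuf); apply: (le_trans Euv).
  apply: leeD; first exact: kinv.
  apply: leeD; last exact: lexx.
  by apply: lee_wpmul2l; [rewrite lee_fin subr_ge0|exact: Mvu].
have : {ae mu, forall t, (`[0, +oo[%classic : set R) t -> tails v t = tails u t}.
  apply: ae_eq_of_integral_le; first exact: measurable_itv.
  - exact: measurable_tails.
  - exact: measurable_tails.
  - by move=> t _; exact: tails_ge0.
  - by move=> t; rewrite /= in_itv/= andbT => /tv.
  - by rewrite -(self_energy_tails cu u1).
  - by rewrite -(self_energy_tails cu u1) -(self_energy_tails cv v1).
apply: filterS; first exact: (ae_filter_ringOfSetsType mu).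
by move=> t h' t0; apply: h'; rewrite /= in_itv/= t0.
Qed.
End comparison.

(** * Euclidean averages *)

Section mix.
Context {R : realType}.
Notation mu := (@lebesgue_measure R).
Implicit Types (g u v k : R -> R) (a b c d x y t : R).

(** The Euclidean norm of [(sqrt (1 - c) a, sqrt c b)]. *)
Definition mix c a b : R := Num.sqrt ((1 - c) * a ^+ 2 + c * b ^+ 2).

Section weight.
Variable c : R.
Hypothesis c01 : 0 <= c <= 1.

Let c0 : 0 <= c. Proof. by have /andP[] := c01. Qed.
Let c1 : 0 <= 1 - c. Proof. by rewrite subr_ge0; have /andP[] := c01. Qed.

Lemma mix_ge0 a b : 0 <= mix c a b. Proof. exact: sqrtr_ge0. Qed.

Lemma mix_sqr a b : mix c a b ^+ 2 = (1 - c) * a ^+ 2 + c * b ^+ 2.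
Proof. by rewrite sqr_sqrtr// addr_ge0// mulr_ge0// sqr_ge0. Qed.

(** Lagrange's identity: the difference of the squares is
    [(1 - c) c (a b' - b a')^2]. *)
Lemma mix_cauchy a b a' b' :
  (1 - c) * (a * a') + c * (b * b') <= mix c a b * mix c a' b'.
Proof.
apply: le_trans (ler_norm _) _.
rewrite -(@ler_pXn2r _ 2)// ?nnegrE ?mulr_ge0 ?mix_ge0//.
rewrite real_normK ?num_real// exprMn !mix_sqr -subr_ge0.
have -> : ((1 - c) * a ^+ 2 + c * b ^+ 2) * ((1 - c) * a' ^+ 2 + c * b' ^+ 2)
    - ((1 - c) * (a * a') + c * (b * b')) ^+ 2 =
    (1 - c) * c * (a * b' - b * a') ^+ 2 by ring.
by rewrite mulr_ge0 ?sqr_ge0// mulr_ge0.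
Qed.

Lemma mix_lip a b a' b' : `|mix c a b - mix c a' b'| <= mix c (a - a') (b - b').
Proof.
rewrite -(@ler_pXn2r _ 2)// ?nnegrE ?mix_ge0//.
rewrite real_normK ?num_real// sqrrB !mix_sqr.
by have := mix_cauchy a b a' b'; lra.
Qed.

Lemma mix_le d a b : 0 <= d -> `|a| <= d -> `|b| <= d -> mix c a b <= d.
Proof.
move=> d0 ad bd; rewrite -(@ler_pXn2r _ 2)// ?nnegrE ?mix_ge0// mix_sqr.
have sq e : `|e| <= d -> e ^+ 2 <= d ^+ 2.
  by move=> ed; rewrite -(real_normK (num_real e)) lerXn2r// nnegrE.
have -> : d ^+ 2 = (1 - c) * d ^+ 2 + c * d ^+ 2 by ring.
by rewrite lerD// ler_wpM2l// sq.
Qed.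

Lemma measurable_mix g1 g2 : measurable_fun setT g1 -> measurable_fun setT g2 ->
  measurable_fun setT (fun x => mix c (g1 x) (g2 x)).
Proof.
move=> m1 m2.
have ms : measurable_fun setT (@Num.sqrt R).
  by apply: continuous_measurable_fun; exact: sqrt_continuous.
apply: (measurableT_comp ms).
by apply: measurable_funD; apply: measurable_funM => //; exact: measurable_funX.
Qed.

(** Minkowski's integral inequality.  With [N] the norm of the pair of integrals,
    [N^2] is the integral of the scalar product of that pair with [(g1, g2)],
    and Cauchy-Schwarz bounds the integrand. *)
Lemma mix_integral D g1 g2 : measurable D ->
  measurable_fun setT g1 -> measurable_fun setT g2 ->
  mu.-integrable D (EFin \o g1) -> mu.-integrable D (EFin \o g2) ->
  mix c (\int[mu]_(x in D) g1 x) (\int[mu]_(x in D) g2 x) <=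
  \int[mu]_(x in D) mix c (g1 x) (g2 x).
Proof.
move=> mD m1 m2 i1 i2.
set X := \int[mu]_(x in D) g1 x; set Y := \int[mu]_(x in D) g2 x; set N := mix c X Y.
have im : mu.-integrable D (EFin \o (fun x => mix c (g1 x) (g2 x))).
  apply: (@le_integrable _ _ _ mu D mD _ (EFin \o (fun x => `|g1 x| + `|g2 x|))).
  - by apply/measurable_EFinP; apply: measurable_funTS; exact: measurable_mix.
  - move=> x _; rewrite /= lee_fin ger0_norm ?mix_ge0// ger0_norm ?addr_ge0//.
    by apply: mix_le; rewrite ?addr_ge0// ?lerDl ?lerDr.
  - by apply: (integrableD mD (integrable_norm i1) (integrable_norm i2)).
have [N0|N0] := eqVneq N 0.
  by rewrite N0; apply: Rintegral_ge0 => x _; exact: mix_ge0.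
have Npos : 0 < N by rewrite lt0r N0 mix_ge0.
rewrite -(ler_pM2l Npos).
have i1' : mu.-integrable D (EFin \o (fun x => (1 - c) * X * g1 x)).
  by apply: eq_integrable (integrableZl mD ((1 - c) * X) i1).
have i2' : mu.-integrable D (EFin \o (fun x => c * Y * g2 x)).
  by apply: eq_integrable (integrableZl mD (c * Y) i2).
have -> : N * N = \int[mu]_(x in D) ((1 - c) * X * g1 x + c * Y * g2 x).
  rewrite RintegralD// !RintegralZl// -/X -/Y -expr2 mix_sqr; ring.
have -> : N * \int[mu]_(x in D) mix c (g1 x) (g2 x) =
    \int[mu]_(x in D) (N * mix c (g1 x) (g2 x)) by rewrite RintegralZl.
apply: le_Rintegral => //.
- by apply: eq_integrable (integrableD mD i1' i2').
- by apply: eq_integrable (integrableZl mD N im).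
- by move=> x _; rewrite -!mulrA; exact: mix_cauchy.
Qed.
End weight.

Lemma Rintegral_opp g a b : measurable_fun setT g ->
  mu.-integrable `[a, b] (EFin \o (fun x => g (- x))) ->
  \int[mu]_(x in `[a, b]) g (- x) = \int[mu]_(x in `[(- b), (- a)]) g x.
Proof.
move=> mg ig; rewrite /Rintegral; congr fine.
have pE : -%R @^-1` (`[(- b), (- a)]%classic : set R) = `[a, b]%classic.
  apply/seteqP; split => x /=; rewrite !in_itv/= => /andP[? ?]; apply/andP; split; lra.
transitivity (\int[pushforward mu (-%R : _ -> measurableTypeR R)]_(x in
    `[(- b)%R, (- a)%R]) (g x)%:E)%E.
  rewrite integral_pushforward//.
  - by rewrite pE.
  - exact/measurable_EFinP.
  - by rewrite pE.
by apply: eq_measure_integral => A mA _; exact: lebesgue_measureN.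
Qed.

Lemma half01 : 0 <= (2^-1 : R) <= 1.
Proof. by apply/andP; split; lra. Qed.

End mix.

(** * The minimiser is even up to sign *)

Section evenness.
Context {R : realType}.
Notation mu := (@lebesgue_measure R).
Implicit Types (g u v k r : R -> R) (a b c d x y t : R).

Lemma ae_exists_itv (P : R -> Prop) a b : {ae mu, forall x, P x} -> a < b ->
  exists2 x, a < x < b & P x.
Proof.
move=> [A [mA A0 PA]] ab; apply: contrapT => nP.
have abA : `]a, b[ `<=` A.
  move=> x /=; rewrite in_itv/= => xab; apply: PA => /= Px.
  by apply: nP; exists x.
have : (mu `]a, b[ <= mu A)%E by rewrite le_measure// inE.
by rewrite [X in (_ <= X)%E]A0 lebesgue_measure_itv/= lte_fin ab -EFinD lee_fin leNgt subr_gt0 ab.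
Qed.

Lemma tail_lin r1 r2 c1 c2 t :
  mu.-integrable setT (EFin \o r1) -> mu.-integrable setT (EFin \o r2) ->
  tail (fun x => c1 * r1 x + c2 * r2 x) t = c1 * tail r1 t + c2 * tail r2 t.
Proof.
move=> i1 i2.
have j1 : mu.-integrable `]t, +oo[ (EFin \o r1) by exact: integrableS i1.
have j2 : mu.-integrable `]t, +oo[ (EFin \o r2) by exact: integrableS i2.
rewrite /tail RintegralD//.
- by rewrite !RintegralZl.
- by apply: eq_integrable (integrableZl _ c1 j1).
- by apply: eq_integrable (integrableZl _ c2 j2).
Qed.

Lemma tail_split r a b : mu.-integrable setT (EFin \o r) -> a <= b ->
  tail r a = \int[mu]_(x in `]a, b]) r x + tail r b.
Proof.
move=> ir ab; rewrite /tail -(@Rintegral_itvB _ r (BRight a) +oo%O b).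
- by rewrite addrC subrK.
- exact: integrableS ir.
- by rewrite bnd_simp.
- by [].
Qed.

(** A tail determines the density as its derivative.  If [r2 x < r1 x], then
    [r1 > r2] to the right of [x], and the two tails cannot agree at two levels
    there, whereas every interval contains levels where they do agree. *)
Lemma continuous_le_of_tails r1 r2 :
  continuous r1 -> continuous r2 ->
  mu.-integrable setT (EFin \o r1) -> mu.-integrable setT (EFin \o r2) ->
  {ae mu, forall t, 0 <= t -> tail r1 t = tail r2 t} ->
  forall x, 0 <= x -> r1 x <= r2 x.
Proof.
move=> c1 c2 i1 i2 ht x x0; rewrite leNgt; apply/negP => r21.
pose e := (r1 x - r2 x) / 2.
have e0 : 0 < e by rewrite divr_gt0// subr_gt0.
have c12 : r1 y - r2 y @[y --> x] --> r1 x - r2 x.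
  by apply: cvgB; [exact: c1|exact: c2].
have [d /= d0 hd] : \forall y \near x, e < r1 y - r2 y.
  by apply: (cvgr_gt _ c12); rewrite /e; lra.
have x1 : x < x + d / 2 by rewrite ltrDl divr_gt0.
have x2 : x + d / 2 < x + d by rewrite ltrD2l ltr_pdivrMr// mulr_natr mulr2n ltrDl.
have [t1 /andP[t1l t1r] et1] := ae_exists_itv ht x1.
have [t2 /andP[t2l t2r] et2] := ae_exists_itv ht x2.
have t12 : t1 <= t2 by rewrite ltW// (lt_trans t1r).
have t10 : 0 <= t1 by rewrite (le_trans x0)// ltW.
have := et1 t10; rewrite (tail_split i1 t12) (tail_split i2 t12) (et2 (le_trans t10 t12)).
move=> /addIr.
have j1 : mu.-integrable `]t1, t2] (EFin \o r1) by exact: integrableS i1.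
have j2 : mu.-integrable `]t1, t2] (EFin \o r2) by exact: integrableS i2.
have je : mu.-integrable `]t1, t2] (EFin \o (fun _ : R => e)).
  apply: (@integrableS _ _ _ mu `[t1, t2]) => //; first exact: subset_itv_oc_cc.
  apply: locally_integrable_itv; apply: continuous_locally_integrable.
  exact: cst_continuous.
apply/eqP; rewrite gt_eqF//.
apply: (@lt_le_trans _ _ (\int[mu]_(y in `]t1, t2]) (r2 y + e))).
  rewrite RintegralD// ltrDl Rintegral_cst//= lebesgue_measure_itv/= lte_fin.
  by rewrite (lt_trans t1r t2l) -EFinD/= mulr_gt0// subr_gt0 (lt_trans t1r).
apply: le_Rintegral => //.
  by apply: eq_integrable (integrableD _ j2 je).
move=> y; rewrite /= in_itv/= => /andP[ty yt].
have : e < r1 y - r2 y.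
  apply: hd; rewrite /= distrC ger0_norm ?subr_ge0; last by rewrite ltW// (lt_trans t1l).
  by rewrite ltrBlDl (le_lt_trans yt).
by lra.
Qed.

Section minimiser.
Variables (z : R) (u : R -> R).
Hypotheses (z1 : 1 <= z) (hX : 1 < z -> minimiser (energy z) (@calX1 R) u)
  (hB : z = 1 -> minimiser (energy z) (@calB1 R) u).

Lemma minimiser_regular : [/\ continuous u, (\int[mu]_x (sq u x)%:E = 1)%E,
  weak_derivative u (wderiv u) & (kinetic u < +oo)%E].
Proof.
have [[cu ex fu] u1] : H1 u /\ norm2 u = 1%E.
  by move: z1; rewrite le_eqVlt => /predU1P[/esym/hB|/hX] [[[? _] ?] _].
split => //; first exact/norm2_eq1.
  exact: wderivP.
by apply: le_lt_trans fu; rewrite kineticE leeDl//; exact: sqre_ge0.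
Qed.

Let cu : continuous u. Proof. by have [] := minimiser_regular. Qed.
Let u1 : (\int[mu]_x (sq u x)%:E = 1)%E. Proof. by have [] := minimiser_regular. Qed.
Let g := wderiv u.
Let gu : is_primitive g u.
Proof. by have [? _ ? _] := minimiser_regular; exact: weak_derivative_primitive. Qed.
Let lg : locally_integrable setT g.
Proof. by have [_ _ [] //] := minimiser_regular. Qed.
Let mg : measurable_fun setT g. Proof. by case: lg. Qed.
Let g2 : (\int[mu]_x (g x ^+ 2)%:E = kinetic u)%E.
Proof. by apply: eq_integral => x _; rewrite real_normK// num_real. Qed.

Let mopp r : measurable_fun setT r -> measurable_fun setT (fun x => r (- x)).
Proof. by move=> mr; exact: measurableT_comp. Qed.

Lemma integral_avg_opp r : measurable_fun setT r -> (forall x, 0 <= r x) ->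
  (\int[mu]_x ((1 - 2^-1) * r x + 2^-1 * r (- x)%R)%:E = \int[mu]_x (r x)%:E)%E.
Proof.
move=> mr r0.
have h0 : 0 <= 1 - 2^-1 :> R by lra.
under eq_integral do rewrite EFinD !EFinM.
rewrite ge0_integralD//.
- rewrite !ge0_integralZl//.
  + rewrite (@ge0_integral_opp R (EFin \o r)).
    * by rewrite -ge0_muleDl ?lee_fin// -EFinD subrK mul1e.
    * exact/measurable_EFinP.
    * by move=> x; rewrite lee_fin.
  + by apply/measurable_EFinP; exact: mopp.
  + by move=> x _; rewrite lee_fin.
  + exact/measurable_EFinP.
  + by move=> x _; rewrite lee_fin.
- by move=> x _; rewrite lee_fin mulr_ge0.
- by apply/measurable_EFinP; exact: measurable_funM.
- by move=> x _; rewrite lee_fin mulr_ge0.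
- by apply/measurable_EFinP; apply: measurable_funM => //; exact: mopp.
Qed.

(** The competitor is [v x = sqrt ((u x ^ 2 + u (- x) ^ 2) / 2)]. *)
Lemma minimiser_even x : sq u x = sq u (- x).
Proof.
have h01 := @half01 R.
pose v x := mix 2^-1 (u x) (u (- x)).
pose k x := mix 2^-1 (g x) (g (- x)).
have mk : measurable_fun setT k by apply: measurable_mix => //; exact: mopp.
have sqvE y : sq v y = (1 - 2^-1) * sq u y + 2^-1 * sq u (- y) by rewrite /sq mix_sqr.
have sqvEN y : sq v (- y) = 2^-1 * sq u y + (1 - 2^-1) * sq u (- y).
  by rewrite sqvE opprK addrC.
have msu : measurable_fun setT (sq u) by exact: measurable_sq.
have isu : mu.-integrable setT (EFin \o sq u).
  by apply: density_integrable => //; [move=> y; exact: sq_ge0|rewrite u1 ltry].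
have iosu : mu.-integrable setT (EFin \o (fun y => sq u (- y))).
  apply: density_integrable => //; [exact: mopp|move=> y; exact: sq_ge0|].
  by rewrite sq_oppE// ltry.
have tE t : tail (sq v) t = (1 - 2^-1) * tail (sq u) t + 2^-1 * tail (fun y => sq u (- y)) t.
  by rewrite -tail_lin//; congr tail; apply/funext => y; exact: sqvE.
have tEN t : tail (fun y => sq v (- y)) t =
    2^-1 * tail (sq u) t + (1 - 2^-1) * tail (fun y => sq u (- y)) t.
  by rewrite -tail_lin//; congr tail; apply/funext => y; exact: sqvEN.
have avg_sqr A B : A ^+ 2 + B ^+ 2 -
    (((1 - 2^-1) * A + 2^-1 * B) ^+ 2 + (2^-1 * A + (1 - 2^-1) * B) ^+ 2) =
    (A - B) ^+ 2 / 2 :> R by field.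
have ht : {ae mu, forall t, 0 <= t -> tails v t = tails u t}.
  apply: (minimiser_tails z1 hX hB mk) => //.
  - by move=> y; exact: mix_ge0.
  - suff -> : (\int[mu]_y (k y ^+ 2)%:E = kinetic u)%E by [].
    rewrite -g2 -[RHS](@integral_avg_opp (fun y => g y ^+ 2)).
    + by apply: eq_integral => y _; rewrite /k mix_sqr.
    + exact: measurable_funX.
    + by move=> y; exact: sqr_ge0.
  - move=> a b ab; apply: (le_trans (mix_lip h01 _ _ _ _)).
    have log : locally_integrable setT (fun y => g (- y)).
      apply: square_integrable_locally; first exact: mopp.
      rewrite (@ge0_integral_opp R (fun y => (g y ^+ 2)%:E)).
      + by rewrite g2; have [] := minimiser_regular.
      + by apply/measurable_EFinP; exact: measurable_funX.
      + by move=> y; rewrite lee_fin sqr_ge0.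
    have iog := locally_integrable_itv a b log.
    have -> : u (- b) - u (- a) = - \int[mu]_(y in `[a, b]) g (- y).
      by rewrite Rintegral_opp// -gu ?opprB// lerN2.
    rewrite gu// /mix sqrrN -/(mix _ _ _).
    apply: mix_integral => //; first exact: mopp.
    exact: locally_integrable_itv.
  - rewrite -u1 -(@integral_avg_opp (sq u))//; last by move=> y; exact: sq_ge0.
    by apply: eq_integral => y _; rewrite sqvE.
  - by move=> t t0; rewrite /tails1 tE tEN; lra.
  - move=> t t0; rewrite /tails tE tEN -subr_ge0.
    by rewrite avg_sqr divr_ge0// sqr_ge0.
have teq : {ae mu, forall t, 0 <= t -> tail (sq u) t = tail (fun y => sq u (- y)) t}.
  apply: filterS ht; first exact: (ae_filter_ringOfSetsType mu).
  move=> t h t0; have := h t0; rewrite /tails tE tEN.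
  move=> /eqP; rewrite eq_sym -subr_eq0 avg_sqr.
  by rewrite mulf_eq0 invr_eq0 pnatr_eq0 orbF sqrf_eq0 subr_eq0 => /eqP.
have teq' : {ae mu, forall t, 0 <= t -> tail (fun y => sq u (- y)) t = tail (sq u) t}.
  apply: filterS teq; first exact: (ae_filter_ringOfSetsType mu).
  by move=> t h /h ->.
have csu : continuous (sq u).
  by move=> y; apply: cvgM; exact: cu.
have cosu : continuous (fun y => sq u (- y)).
  by move=> y; apply: (@continuous_comp _ _ _ -%R (sq u)); [exact: opp_continuous|exact: csu].
have main y : 0 <= y -> sq u y = sq u (- y).
  move=> y0; apply/eqP; rewrite eq_le.
  rewrite (continuous_le_of_tails csu cosu isu iosu teq y0).
  exact: (continuous_le_of_tails cosu csu iosu isu teq' y0).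
have [/main//|/ltW x0] := leP 0 x.
by rewrite (main (- x)) ?opprK// oppr_ge0.
Qed.
End minimiser.
End evenness.

(** * The minimiser is nonincreasing up to sign *)

Section monotonicity.
Context {R : realType}.
Notation mu := (@lebesgue_measure R).
Implicit Types (g u v k r h : R -> R) (a b c d x y t p q : R).

Lemma le_Rintegral_subset h (A D : set R) : measurable A -> measurable D -> A `<=` D ->
  (forall x, 0 <= h x) -> mu.-integrable D (EFin \o h) ->
  \int[mu]_(x in A) h x <= \int[mu]_(x in D) h x.
Proof.
move=> mA mD AD h0 ih.
have iA : mu.-integrable A (EFin \o h) by exact: integrableS ih.
rewrite -lee_fin /Rintegral !fineK ?integrable_fin_num//.
apply: ge0_subset_integral => //; first by case/integrableP: ih.
by move=> x _; rewrite lee_fin.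
Qed.

Lemma Rintegral_gt0 h p q (D : set R) : continuous h -> (forall x, 0 <= h x) ->
  0 < h p -> p < q -> measurable D -> `]p, q[ `<=` D ->
  mu.-integrable D (EFin \o h) -> 0 < \int[mu]_(x in D) h x.
Proof.
move=> ch h0 hp pq mD pqD ih.
have hp2 : h p / 2 < h p by lra.
have [d /= d0 hd] := cvgr_gt _ (ch p) _ hp2.
pose q' := Num.min q (p + d).
have pq' : p < q' by rewrite lt_min pq ltrDl.
have q'q : `]p, q'[ `<=` `]p, q[ by apply: subset_itvl; rewrite bnd_simp ge_min lexx.
have iq' : mu.-integrable `]p, q'[ (EFin \o h).
  by apply: integrableS ih => //; exact: subset_trans pqD.
apply: (@lt_le_trans _ _ (\int[mu]_(x in `]p, q'[) h x)); last first.
  by apply: le_Rintegral_subset => //; exact: subset_trans pqD.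
apply: (@lt_le_trans _ _ (\int[mu]_(x in `]p, q'[) (h p / 2))).
  rewrite Rintegral_cst//= lebesgue_measure_itv/= lte_fin pq' -EFinD/= mulr_gt0 ?subr_gt0//.
  by rewrite divr_gt0.
apply: le_Rintegral => //.
  apply: (@integrableS _ _ _ mu `[p, q']) => //; first exact: subset_itv_oo_cc.
  by apply: locally_integrable_itv; apply: continuous_locally_integrable; exact: cst_continuous.
move=> x /=; rewrite in_itv/= => /andP[px xq']; apply/ltW/hd => /=.
rewrite distrC ger0_norm ?subr_ge0 ?ltW// ltrBlDl (lt_le_trans xq')//.
by rewrite ge_min lexx orbT.
Qed.

Lemma even_integral_tail r : measurable_fun setT r -> (forall x, 0 <= r x) ->
  (forall x, r (- x) = r x) -> (\int[mu]_x (r x)%:E < +oo)%E ->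
  (\int[mu]_x (r x)%:E = (2 * tail r 0)%:E)%E.
Proof.
move=> mr r0 er ir.
have mrE (D : set R) : measurable D -> measurable_fun D (EFin \o r).
  by move=> mD; apply/measurable_EFinP; exact: measurable_funTS.
have e1 : (\int[mu]_(x in `]-oo, 0%R]) (r x)%:E = (tail r 0)%:E)%E.
  rewrite tailE// integral_itv_obnd_cbnd; last exact: mrE.
  rewrite (@ge0_integration_by_substitution0 R (EFin \o r)).
  - by apply: eq_integral => x _ /=; rewrite er.
  - exact: mrE.
  - by move=> x; rewrite lee_fin.
have -> : [set: R] = `]-oo, 0%R] `|` `]0%R, +oo[.
  by apply/seteqP; split => // x _ /=; rewrite !in_itv/= andbT; case: (leP x 0); [left|right].
rewrite ge0_integral_setU//=.
- by rewrite e1 -tailE// -EFinD; congr EFin; ring.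
- by apply: mrE; exact: measurableU.
- by move=> x _; rewrite lee_fin.
- apply/disj_setPRL => x /=; rewrite !in_itv/= andbT => x0.
  by apply/negP; rewrite -ltNge.
Qed.

Section minimiser.
Variables (z : R) (u : R -> R).
Hypotheses (z1 : 1 <= z) (hX : 1 < z -> minimiser (energy z) (@calX1 R) u)
  (hB : z = 1 -> minimiser (energy z) (@calB1 R) u).

Let cu : continuous u. Proof. by have [] := minimiser_regular z1 hX hB. Qed.
Let u1 : (\int[mu]_x (sq u x)%:E = 1)%E. Proof. by have [] := minimiser_regular z1 hX hB. Qed.
Let g := wderiv u.
Let gu : is_primitive g u.
Proof. by have [? _ ? _] := minimiser_regular z1 hX hB; exact: weak_derivative_primitive. Qed.
Let lg : locally_integrable setT g.
Proof. by have [_ _ [] //] := minimiser_regular z1 hX hB. Qed.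
Let mg : measurable_fun setT g. Proof. by case: lg. Qed.

Let ng x := `|g x|.

Let mng : measurable_fun setT ng. Proof. exact: measurableT_comp. Qed.

Let u_lip a b : a <= b -> `|u b - u a| <= \int[mu]_(x in `[a, b]) ng x.
Proof.
by move=> ab; rewrite gu//; apply: le_normr_Rintegral => //; exact: locally_integrable_itv.
Qed.

Let lng : locally_integrable setT ng.
Proof.
split; [exact: mng|exact: openT|move=> K KT cK].
by case: lg => _ _ /(_ K KT cK); under eq_integral do rewrite -normr_id.
Qed.

Section filling.
Variables (b l al be : R).
Hypotheses (b0 : 0 < b) (l0 : 0 <= l) (ub : `|u b| = l)
  (al01 : 0 <= al <= 1) (be01 : 0 <= be <= 1).

Let inner t := mix be (u t) (Num.max `|u t| l).
Let outer t := mix al (u t) (Num.min `|u t| l).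

(** The square is raised towards [l^2] inside [-b, b] and lowered towards it
    outside.  At [b] and [- b] both formulas give [l], which keeps the function
    continuous. *)
Definition refill t := if `|t| <= b then inner t else outer t.

Let max_lip x y : `|Num.max `|x| l - Num.max `|y| l| <= `|x - y|.
Proof.
apply: le_trans (ler_dist_dist x y); rewrite /Num.max.
have := ler_norm (`|x| - `|y|); have := ler_norm (`|y| - `|x|); rewrite (distrC `|y|).
by move=> ? ?; case: (ltP `|x| l) => ?; case: (ltP `|y| l) => ?; rewrite ler_norml;
  apply/andP; split; lra.
Qed.

Let min_lip x y : `|Num.min `|x| l - Num.min `|y| l| <= `|x - y|.
Proof.
apply: le_trans (ler_dist_dist x y); rewrite /Num.min.
have := ler_norm (`|x| - `|y|); have := ler_norm (`|y| - `|x|); rewrite (distrC `|y|).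
by move=> ? ?; case: (ltP `|x| l) => ?; case: (ltP `|y| l) => ?; rewrite ler_norml;
  apply/andP; split; lra.
Qed.

Let inner_lip p q : p <= q -> `|inner q - inner p| <= \int[mu]_(x in `[p, q]) ng x.
Proof.
move=> pq; apply: le_trans (u_lip pq); apply: (le_trans (mix_lip be01 _ _ _ _)).
by apply: mix_le.
Qed.

Let outer_lip p q : p <= q -> `|outer q - outer p| <= \int[mu]_(x in `[p, q]) ng x.
Proof.
move=> pq; apply: le_trans (u_lip pq); apply: (le_trans (mix_lip al01 _ _ _ _)).
by apply: mix_le.
Qed.

Hypothesis ueven : forall x, sq u x = sq u (- x).

Let normu_even x : `|u (- x)| = `|u x|.
Proof. by rewrite -!sqrtr_sqr -!/(sq _ _) -ueven. Qed.

Let inner_b t : `|t| = b -> inner t = outer t.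
Proof.
move=> tb; have ut : `|u t| = l.
  by rewrite -ub -tb; case: (ger0P t) => // _; rewrite normu_even.
have ml c : mix c (u t) l = l.
  rewrite /mix -(real_normK (num_real (u t))) ut.
  have -> : (1 - c) * l ^+ 2 + c * l ^+ 2 = l ^+ 2 by ring.
  by rewrite sqrtr_sqr ger0_norm.
by rewrite /inner /outer ut maxxx minxx !ml.
Qed.

(** Each of the three pieces is a 1-Lipschitz function of [u], and they agree at
    [- b] and [b], where the bounds are glued. *)
Lemma refill_lip p q : p <= q ->
  `|refill q - refill p| <= \int[mu]_(x in `[p, q]) ng x.
Proof.
have glue c p' q' : p' <= c -> c <= q' ->
    `|refill c - refill p'| <= \int[mu]_(x in `[p', c]) ng x ->
    `|refill q' - refill c| <= \int[mu]_(x in `[c, q']) ng x ->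
    `|refill q' - refill p'| <= \int[mu]_(x in `[p', q']) ng x.
  move=> pc cq h1 h2; rewrite (Rintegral_chasles lng pc cq).
  apply: (le_trans (ler_distD (refill c) _ _)).
  by rewrite addrC lerD.
have refill_in t : - b <= t -> t <= b -> refill t = inner t.
  by move=> bt tb; rewrite /refill ler_norml bt tb.
have refill_r t : b <= t -> refill t = outer t.
  move=> bt; rewrite /refill; case: ifPn => // tb; apply: inner_b.
  have t0 : 0 <= t by rewrite (le_trans (ltW b0)).
  by apply/eqP; rewrite eq_le tb/= ger0_norm.
have refill_l t : t <= - b -> refill t = outer t.
  move=> bt; rewrite /refill; case: ifPn => // tb; apply: inner_b.
  have t0 : t <= 0 by rewrite (le_trans bt)// oppr_le0 ltW.
  by apply/eqP; rewrite eq_le tb/= ler0_norm// lerNr.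
have L p' q' : p' <= q' -> q' <= - b ->
    `|refill q' - refill p'| <= \int[mu]_(x in `[p', q']) ng x.
  by move=> pq qb; rewrite !refill_l ?(le_trans pq)//; exact: outer_lip.
have M p' q' : p' <= q' -> - b <= p' -> q' <= b ->
    `|refill q' - refill p'| <= \int[mu]_(x in `[p', q']) ng x.
  by move=> pq bp qb; rewrite !refill_in ?(le_trans bp)// ?(le_trans pq)//; exact: inner_lip.
have H p' q' : p' <= q' -> b <= p' ->
    `|refill q' - refill p'| <= \int[mu]_(x in `[p', q']) ng x.
  by move=> pq bp; rewrite !refill_r ?(le_trans bp)//; exact: outer_lip.
have bb : - b <= b by rewrite (@le_trans _ _ 0) ?oppr_le0// ltW.
have MH p' q' : p' <= q' -> - b <= p' ->
    `|refill q' - refill p'| <= \int[mu]_(x in `[p', q']) ng x.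
  move=> pq bp; have [qb|bq] := leP q' b; first exact: M.
  have [pb|bp'] := leP p' b; last by apply: H => //; exact: ltW.
  by apply: (glue b) => //; [exact: ltW|exact: M|apply: H => //; exact: ltW].
move=> pq; have [bp|pb] := leP (- b) p; first exact: MH.
have [qb|bq] := leP q (- b); first exact: L.
apply: (glue (- b)); [exact: ltW|exact: ltW|apply: L => //; exact: ltW|].
by apply: MH => //; exact: ltW.
Qed.

Definition excess t := Num.max 0 (sq u t - l ^+ 2).
Definition deficit t := Num.max 0 (l ^+ 2 - sq u t).

Let max_sqr a : 0 <= a -> Num.max a l ^+ 2 = a ^+ 2 + Num.max 0 (l ^+ 2 - a ^+ 2).
Proof.
move=> a0; have [ale|la] := leP a l.
  by rewrite max_r ?subr_ge0 ?lerXn2r// addrC subrK.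
by rewrite max_l ?addr0// subr_le0 lerXn2r// ?nnegrE// ltW.
Qed.

Let min_sqr a : 0 <= a -> Num.min a l ^+ 2 = a ^+ 2 - Num.max 0 (a ^+ 2 - l ^+ 2).
Proof.
move=> a0; have [ale|la] := leP a l.
  by rewrite max_l ?subr0// subr_le0 lerXn2r.
by rewrite max_r ?subr_ge0 ?lerXn2r ?nnegrE ?(ltW la)// opprB addrC subrK.
Qed.

Lemma sq_refill_in t : `|t| <= b -> sq refill t = sq u t + be * deficit t.
Proof.
move=> tb; rewrite /sq /refill tb mix_sqr// max_sqr// real_normK ?num_real//.
by rewrite /deficit /sq; ring.
Qed.

Lemma sq_refill_out t : b < `|t| -> sq refill t = sq u t - al * excess t.
Proof.
move=> tb; rewrite /sq /refill leNgt tb/= mix_sqr// min_sqr// real_normK ?num_real//.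
by rewrite /excess /sq; ring.
Qed.

Let deficit_ge0 t : 0 <= deficit t. Proof. by rewrite le_max lexx. Qed.
Let excess_ge0 t : 0 <= excess t. Proof. by rewrite le_max lexx. Qed.

Let csu : continuous (sq u). Proof. by move=> y; apply: cvgM; exact: cu. Qed.
Let msu : measurable_fun setT (sq u). Proof. exact: measurable_sq. Qed.

Lemma continuous_deficit : continuous deficit.
Proof.
move=> y; apply: (@continuous_max R R (cst 0) (fun t => l ^+ 2 - sq u t) y).
  exact: cvg_cst.
by apply: cvgB; [exact: cvg_cst|exact: csu].
Qed.

Let continuous_excess : continuous excess.
Proof.
move=> y; apply: (@continuous_max R R (cst 0) (fun t => sq u t - l ^+ 2) y).
  exact: cvg_cst.
by apply: cvgB; [exact: csu|exact: cvg_cst].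
Qed.

Let isu : mu.-integrable setT (EFin \o sq u).
Proof. by apply: density_integrable => //; [move=> y; exact: sq_ge0|rewrite u1 ltry]. Qed.

Let iexcess : mu.-integrable setT (EFin \o excess).
Proof.
apply: le_integrable isu => //.
  by apply/measurable_EFinP; exact: continuous_measurable_fun.
move=> x _ /=; rewrite lee_fin !ger0_norm ?sq_ge0//.
by rewrite /excess ge_max sq_ge0/= lerBlDr lerDl sqr_ge0.
Qed.

Let ideficit p q : mu.-integrable `[p, q] (EFin \o deficit).
Proof.
apply: locally_integrable_itv; apply: continuous_locally_integrable.
exact: continuous_deficit.
Qed.

Let msqv : measurable_fun setT (sq refill).
Proof.
have mu0 : measurable_fun setT u by exact: continuous_measurable_fun.
have mnu : measurable_fun setT (fun x => `|u x|) by exact: measurableT_comp.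
have mn : measurable_fun setT (fun x : R => `|x|) by exact: measurableT_comp.
apply: measurable_funX; apply: measurable_fun_ifT.
- by apply: measurable_fun_ler.
- by apply: measurable_mix => //; apply: measurable_maxr.
- by apply: measurable_mix => //; apply: measurable_minr.
Qed.

Let isqv : mu.-integrable setT (EFin \o sq refill).
Proof.
(* A majorant: the square is raised at most to [l^2], and only inside. *)
pose h x : R := sq u x + l ^+ 2 * \1_(`[- b, b]%classic) x.
have ih : mu.-integrable setT (EFin \o h).
  have i1 := @integrable_indic_itv R (- b) b true false.
  apply: eq_integrable (integrableD _ isu (integrableZl _ (l ^+ 2) i1)) => //.
apply: le_integrable ih => //; first exact/measurable_EFinP.
move=> x _ /=; rewrite lee_fin !ger0_norm ?sq_ge0//; last first.
  by rewrite addr_ge0 ?sq_ge0// mulr_ge0// sqr_ge0.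
rewrite /h indicE mem_setE in_itv/= -ler_norml; have [xb|bx] := leP `|x| b.
- rewrite sq_refill_in// lerD2l mulr1.
  have dl : deficit x <= l ^+ 2 by rewrite /deficit ge_max sqr_ge0/= lerBlDr lerDl sq_ge0.
  by have /andP[? ?] := be01; rewrite (le_trans _ dl)// ler_piMl.
- rewrite sq_refill_out// mulr0 addr0 lerBlDr lerDl mulr_ge0//.
  by have /andP[] := al01.
Qed.

Let Adef := \int[mu]_(x in `[0, b]) deficit x.
Let Rexc := tail excess b.

Hypothesis mass_match : be * Adef = al * Rexc.

Lemma tail_refill_out t : b <= t -> tail (sq refill) t = tail (sq u) t - al * tail excess t.
Proof.
move=> bt; rewrite -mulNr -[tail (sq u) t]mul1r -tail_lin//.
apply: eq_Rintegral => y; rewrite inE/= in_itv/= andbT => ty.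
rewrite sq_refill_out; first by rewrite mul1r mulNr.
by rewrite (lt_le_trans (le_lt_trans bt ty))// ler_norm.
Qed.

Let tail_refill_in t : 0 <= t -> t <= b -> tail (sq refill) t =
  tail (sq u) t + be * (\int[mu]_(x in `]t, b]) deficit x - Adef).
Proof.
move=> t0 tb; rewrite (tail_split isqv tb) (tail_split isu tb) tail_refill_out//.
rewrite -/Rexc mulrBr mass_match.
have iu' : mu.-integrable `]t, b] (EFin \o sq u) by exact: integrableS isu.
have id' : mu.-integrable `]t, b] (EFin \o deficit).
  by apply: integrableS (ideficit t b) => //; exact: subset_itv_oc_cc.
have -> : \int[mu]_(x in `]t, b]) sq refill x =
    \int[mu]_(x in `]t, b]) sq u x + be * \int[mu]_(x in `]t, b]) deficit x.
  rewrite -RintegralZl// -RintegralD//.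
    apply: eq_Rintegral => y; rewrite inE/= in_itv/= => /andP[ty yb].
    by rewrite sq_refill_in// ger0_norm// (le_trans t0)// ltW.
  by apply: eq_integrable (integrableZl _ be id').
by ring.
Qed.

(** Beyond [b] mass is only removed.  For [t <= b] the mass removed beyond [b] is
    that added to [0, b] by [mass_match], of which only a part lies beyond
    [t]. *)
Lemma tail_refill_le t : 0 <= t -> tail (sq refill) t <= tail (sq u) t.
Proof.
move=> t0; have [tb|bt] := leP t b.
  rewrite tail_refill_in// gerDl.
  have /andP[? ?] := be01; rewrite mulr_ge0_le0// subr_le0.
  apply: le_Rintegral_subset => //.
  by move=> x /=; rewrite !in_itv/= => /andP[tx ->]; rewrite andbT (le_trans t0)// ltW.
rewrite tail_refill_out ?(ltW bt)// gerBl; have /andP[? ?] := al01.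
by rewrite mulr_ge0//; exact: tail_ge0.
Qed.

Let refill_even t : sq refill (- t) = sq refill t.
Proof.
have [tb|bt] := leP `|t| b.
  by rewrite !sq_refill_in ?normrN// /deficit -ueven.
by rewrite !sq_refill_out ?normrN// /excess -ueven.
Qed.

Lemma refill_normalised : (\int[mu]_x (sq refill x)%:E = 1)%E.
Proof.
rewrite even_integral_tail//; [|by move=> x; exact: sq_ge0|].
  rewrite tail_refill_in ?(ltW b0)// Rintegral_itv_obnd_cbnd; last first.
    by apply: integrableS (ideficit 0 b) => //; exact: subset_itv_oc_cc.
  rewrite subrr mulr0 addr0 -u1 (@even_integral_tail (sq u))//.
  - by move=> x; exact: sq_ge0.
  - by rewrite u1 ltry.
case/integrableP: isqv => _; apply: le_lt_trans; rewrite le_eqVlt; apply/orP; left; apply/eqP.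
by apply: eq_integral => x _ /=; rewrite ger0_norm// sq_ge0.
Qed.

(** By rigidity the tail of [al * excess] vanishes at some level between [b] and
    [y]; the excess is continuous and nonnegative, so it cannot be positive at
    [y] unless [al] is 0. *)
Lemma refill_rigid y : b < y -> al * excess y <= 0.
Proof.
move=> bly.
have tvE w : (forall t, sq w (- t) = sq w t) -> forall t, tails w t = 2 * tail (sq w) t ^+ 2.
  move=> ew t; rewrite /tails (_ : (fun x => sq w (- x)) = sq w); first by ring.
  by apply/funext => x; exact: ew.
have tv1E w : (forall t, sq w (- t) = sq w t) -> forall t, tails1 w t = 2 * tail (sq w) t.
  move=> ew t; rewrite /tails1 (_ : (fun x => sq w (- x)) = sq w); first by ring.
  by apply/funext => x; exact: ew.
have eu t : sq u (- t) = sq u t by rewrite -ueven.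
have t0 w t : 0 <= tail (sq w) t by apply: tail_ge0 => x; exact: sq_ge0.
have ht : {ae mu, forall t, 0 <= t -> tails refill t = tails u t}.
  apply: (minimiser_tails z1 hX hB mng) => //.
  - by move=> x; exact: normr_ge0.
  - exact: refill_lip.
  - exact: refill_normalised.
  - by move=> t tp; rewrite !tv1E// ler_pM2l// tail_refill_le.
  - by move=> t tp; rewrite !tvE// ler_pM2l// lerXn2r ?nnegrE// tail_refill_le.
have [t /andP[bt ty]] := ae_exists_itv ht bly.
have tp : 0 <= t by rewrite (le_trans (ltW b0))// ltW.
move=> /(_ tp); rewrite !tvE// => /mulfI; rewrite pnatr_eq0 => /(_ isT)/eqP.
rewrite eqrXn2// tail_refill_out ?(ltW bt)// => /eqP tE.
have alt : al * tail excess t = 0 by move: tE; lra.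
have /andP[al0 _] := al01.
have [->|ey0] := eqVneq (excess y) 0; first by rewrite mulr0.
have ey : 0 < excess y by rewrite lt0r ey0 excess_ge0.
have te : 0 < tail excess t.
  apply: (@Rintegral_gt0 _ y (y + 1)) => //; first by rewrite ltrDl.
    by move=> x /=; rewrite !in_itv/= andbT => /andP[yx _]; exact: lt_trans yx.
  exact: integrableS iexcess.
move/eqP: alt; rewrite mulf_eq0 (gt_eqF te) orbF => /eqP ->.
by rewrite mul0r.
Qed.

End filling.

(** Otherwise [b] is chosen where [|u|] is the mean of [|u x| < |u y|], and the
    proportions [al] and [be] are the ones that balance the mass removed and
    added.  The deficit is positive at [x], so [al > 0], and the excess is
    positive at [y]. *)
Lemma minimiser_nonincreasing x y : 0 <= x -> x <= y -> `|u y| <= `|u x|.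
Proof.
move=> x0; rewrite le_eqVlt => /predU1P[->//|xy]; rewrite leNgt; apply/negP => uxy.
have cnu : continuous (fun t => `|u t|).
  by move=> t; apply: (@continuous_comp _ _ _ u Num.norm); [exact: cu|exact: norm_continuous].
pose m := (`|u x| + `|u y|) / 2.
have [b] : exists2 b, b \in `[x, y] & `|u b| = m.
  apply: (@IVT _ (fun t => `|u t|)); [exact: ltW|exact: continuous_subspaceT|].
  by rewrite min_l ?max_r ?(ltW uxy)// /m; apply/andP; split; lra.
rewrite in_itv/= => /andP[xb bly] ub.
have {}xb : x < b.
  by rewrite lt_neqAle xb andbT; apply/eqP => xbE; move: ub uxy; rewrite /m -xbE; lra.
have {}bly : b < y.
  by rewrite lt_neqAle bly andbT; apply/eqP => byE; move: ub uxy; rewrite /m byE; lra.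
have b0 : 0 < b by exact: le_lt_trans xb.
pose l := `|u b|; have l0 : 0 <= l by exact: normr_ge0.
pose A := \int[mu]_(t in `[0, b]) deficit l t; pose E := tail (excess l) b.
have A0 : 0 < A.
  apply: (@Rintegral_gt0 _ x b) => //.
  - exact: continuous_deficit.
  - by move=> t; rewrite le_max lexx.
  - rewrite /deficit lt_max; apply/orP; right; rewrite subr_gt0 /sq.
    rewrite -(real_normK (num_real (u x))) ltrXn2r// ?nnegrE//.
    by rewrite /l ub /m; lra.
  - move=> t /=; rewrite !in_itv/= => /andP[xt tb].
    by rewrite (ltW tb) andbT ltW// (le_lt_trans x0).
  - apply: locally_integrable_itv; apply: continuous_locally_integrable.
    exact: continuous_deficit.
have E0 : 0 <= E by apply: tail_ge0 => t; rewrite le_max lexx.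
have AE : 0 < A + E by rewrite ltr_pwDl.
have al01 : 0 <= A / (A + E) <= 1.
  by rewrite divr_ge0 ?(ltW A0) ?(ltW AE)//= ler_pdivrMr// mul1r lerDl.
have be01 : 0 <= E / (A + E) <= 1.
  by rewrite divr_ge0 ?(ltW AE)//= ler_pdivrMr// mul1r lerDr ltW.
have mass : E / (A + E) * A = A / (A + E) * E by ring.
have := refill_rigid b0 l0 erefl al01 be01 (minimiser_even z1 hX hB) mass bly.
rewrite leNgt => /negP; apply; rewrite mulr_gt0 ?divr_gt0//.
rewrite /excess lt_max; apply/orP; right; rewrite subr_gt0 /sq.
rewrite -(real_normK (num_real (u y))) ltrXn2r// ?nnegrE//.
by rewrite /l ub /m; lra.
Qed.
End minimiser.
End monotonicity.

(** * Absence of sign changes *)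

Section sign.
Context {R : realType}.
Implicit Types (u : R -> R) (x y : R).

(** A continuous function whose modulus is nonincreasing away from the origin
    cannot return from a zero. *)
Lemma ge0_of_norm_nonincreasing u : continuous u ->
  (forall x y, `|x| <= `|y| -> `|u y| <= `|u x|) -> 0 <= u 0 ->
  forall x, 0 <= u x.
Proof.
move=> cu mu u0 x; rewrite leNgt; apply/negP => ux.
have [c cx uc] : exists2 c, `|c| <= `|x| & u c = 0.
  have [x0|x0] := leP 0 x.
    have [] := @IVT _ u 0 x 0 x0 (continuous_subspaceT cu).
      by rewrite min_r ?max_l ?(ltW ux) ?(le_trans (ltW ux)).
    by move=> c; rewrite in_itv/= => /andP[c0 cx] uc; exists c => //; rewrite !ger0_norm.
  have [] := @IVT _ u x 0 0 (ltW x0) (continuous_subspaceT cu).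
    by rewrite min_l ?max_r ?(ltW ux) ?(le_trans (ltW ux)).
  move=> c; rewrite in_itv/= => /andP[xc c0] uc; exists c => //.
  by rewrite !ler0_norm ?lerN2// ltW.
by have := mu _ _ cx; rewrite uc normr0 normr_le0 => /eqP ux0; move: ux; rewrite ux0 ltxx.
Qed.

Lemma symmetric_nonincreasing_ge0 u : continuous u ->
  (forall x, `|u (- x)| = `|u x|) ->
  (forall x y, 0 <= x -> x <= y -> `|u y| <= `|u x|) -> 0 <= u 0 ->
  symmetric_nonincreasing u.
Proof.
move=> cu eu mu u0.
have nu x : `|u `|x| | = `|u x| by case: (ger0P x) => // _; rewrite eu.
have up : forall x, 0 <= u x.
  apply: ge0_of_norm_nonincreasing => // x y xy.
  by rewrite -(nu x) -(nu y); apply: mu.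
split=> [x|x y x0 xy].
- by have := eu x; rewrite !ger0_norm.
- by have := mu _ _ x0 xy; rewrite !ger0_norm.
Qed.
End sign.

(* The energy is invariant under u |-> - u, so monotonicity can only hold up to
   a global sign; for u >= 0 the second alternative is impossible. *)
Theorem corollary23 (R : realType) (z : R) (u : R -> R)
  (hz : 1 <= z)
  (hX : 1 < z -> minimiser (energy z) (@calX1 R) u)
  (hB : z = 1 -> minimiser (energy z) (@calB1 R) u) :
  symmetric_nonincreasing u \/ symmetric_nonincreasing (fun x => - u x).
Proof.
have [cu _ _ _] := minimiser_regular hz hX hB.
have eu x : `|u (- x)| = `|u x|.
  by rewrite -!sqrtr_sqr -!/(sq _ _) -(minimiser_even hz hX hB).
have mu := minimiser_nonincreasing hz hX hB.
have [u0|u0] := leP 0 (u 0).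
  by left; exact: symmetric_nonincreasing_ge0.
right; apply: symmetric_nonincreasing_ge0.
- by move=> x; apply: cvgN; exact: cu.
- by move=> x; rewrite !normrN.
- by move=> x y; rewrite !normrN; exact: mu.
- by rewrite oppr_ge0 ltW.
Qed.
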